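(* Suppose that Assumption (A') (stated in the context) holds and let $\{(x^k,z^k,y^k)\}_{k\ge0}$ be a sequence generated by Algorithm 1 or Algorithm 2, which is assumed to be bounded. Suppose further that $\mathcal{F}_r$ satisfies the Łojasiewicz property with Łojasiewicz constant $C_L>0$ and Łojasiewicz exponent $\theta\in[0,1)$ (in the sense of the context). Let $(\widehat x,\widehat z,\widehat y)$ be the KKT point of the optimization problem $\min_{x\in\mathbb{R}^n}\{g(Ax)+h(x)\}$ to which $\{(x^k,z^k,y^k)\}_{k\ge0}$ converges as $k\to+\infty$. Then: (i) if $\theta=0$, then the algorithms converge in finite time, i.e. $(x^k,z^k,y^k)=(\widehat x,\widehat z,\widehat y)$ for all $k$ from some index on; (ii) if $\theta\in(0,1/2]$, then there exist $k_0\ge1$, $\widehat C_{0,1},\widehat C_{0,2},\widehat C_{0,3}>0$ and $\widehat Q\in[0,1)$ such that for every $k\ge k_0$ $$\|x^k-\widehat x\|\le\widehat C_{0,1}\widehat Q^k,\quad\|y^k-\widehat y\|\le\widehat C_{0,2}\widehat Q^k,\quad\|z^k-\widehat z\|\le\widehat C_{0,3}\widehat Q^k;$$ (iii) if $\theta\in(1/2,1)$, then there exist $k_0\ge3$ and $\widehat C_{1,1},\widehat C_{1,2},\widehat C_{1,3}>0$ such that for every $k\ge k_0$ $$\|x^k-\widehat x\|\le\widehat C_{1,1}(k-1)^{-\frac{1-\theta}{2\theta-1}},\quad\|y^k-\widehat y\|\le\widehat C_{1,2}(k-1)^{-\frac{1-\theta}{2\theta-1}},\quad\|z^k-\widehat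 z\|\le\widehat C_{1,3}(k-2)^{-\frac{1-\theta}{2\theta-1}}.$$
   Context: Setting. All spaces $\mathbb{R}^N$ carry the Euclidean inner product $\langle\cdot,\cdot\rangle$ and norm $\|\cdot\|$; matrices carry the operator norm. $g\colon\mathbb{R}^m\to\mathbb{R}\cup\{+\infty\}$ is proper and lower semicontinuous, $h\colon\mathbb{R}^n\to\mathbb{R}$ is Fréchet differentiable with $L$-Lipschitz continuous gradient, $A\colon\mathbb{R}^n\to\mathbb{R}^m$ is linear with adjoint $A^*$. For a symmetric matrix $M$ put $\|x\|_M^2:=\langle Mx,x\rangle$; $M\succcurlyeq M'$ means $\|x\|_M^2\ge\|x\|_{M'}^2$ for all $x$; $\mathrm{Id}$ is the identity matrix; $\lambda_{\min}$ denotes the smallest eigenvalue. The augmented Lagrangian is $\mathcal{L}_r(x,z,y)=g(z)+h(x)+\langle y,Ax-z\rangle+\frac r2\|Ax-z\|^2$ on $\mathbb{R}^n\times\mathbb{R}^m\times\mathbb{R}^m$. Subdifferential. For $\Psi\colon\mathbb{R}^N\to\mathbb{R}\cup\{+\infty\}$ proper lower semicontinuous and $x$ with $\Psi(x)<+\infty$, the Fréchet subdifferential is $\widehat\partial\Psi(x)=\{d:\liminf_{y\to x}\frac{\Psi(y)-\Psi(x)-\langle d,y-x\rangle}{\|y-x\|}\ge0\}$, and the limiting subdifferential $\partial\Psi(x)$ is the set of $d$ for which there are $x^k\to x$, $d^k\to d$ with $\Psi(x^k)\to\Psi(x)$ and $d^k\in\widehat\partial\Psi(x^k)$ for all $k$;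 both are empty where $\Psi=+\infty$. $\mathrm{dist}(x,\Omega)=\inf_{y\in\Omega}\|x-y\|$ (with $\inf\emptyset=+\infty$). A KKT point of $\min_x\{g(Ax)+h(x)\}$ is a triple $(\widehat x,\widehat z,\widehat y)\in\mathbb{R}^n\times\mathbb{R}^m\times\mathbb{R}^m$ with $-A^*\widehat y=\nabla h(\widehat x)$, $\widehat y\in\partial g(\widehat z)$, $\widehat z=A\widehat x$. Algorithms. Let $\{\mathbf{M}_1^k\}_{k\ge0}\subseteq\mathbb{R}^{n\times n}$, $\{\mathbf{M}_2^k\}_{k\ge0}\subseteq\mathbb{R}^{m\times m}$ be sequences of symmetric positive semidefinite matrices, $r>0$, $0<\rho<2$, and $(x^0,z^0,y^0)\in\mathbb{R}^n\times\mathbb{R}^m\times\mathbb{R}^m$. Both algorithms generate, for every $k\ge0$, $$z^{k+1}\in\arg\min_{z\in\mathbb{R}^m}\Big\{g(z)+\langle y^k,Ax^k-z\rangle+\tfrac r2\|Ax^k-z\|^2+\tfrac12\|z-z^k\|_{\mathbf{M}_2^k}^2\Big\},$$ then $x^{k+1}$, then $y^{k+1}:=y^k+\rho r(Ax^{k+1}-z^{k+1})$, where in Algorithm 1 $$x^{k+1}\in\arg\min_{x\in\mathbb{R}^n}\Big\{h(x)+\langle y^k,Ax-z^{k+1}\rangle+\tfrac r2\|Ax-z^{k+1}\|^2+\tfrac12\|x-x^k\|_{\mathbf{M}_1^k}^2\Big\},$$ and in Algorithm 2 $$x^{k+1}\in\arg\min_{x\in\mathbb{R}^n}\Big\{\langle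 x-x^k,\nabla h(x^k)\rangle+\langle y^k,Ax-z^{k+1}\rangle+\tfrac r2\|Ax-z^{k+1}\|^2+\tfrac12\|x-x^k\|_{\mathbf{M}_1^k}^2\Big\}.$$ Assumption (A'). (i) $g$ and $h$ are bounded from below; (ii) $A$ is surjective, and we set $T_0:=\frac{1}{\lambda_{\min}(AA^* )\rho}$ if $0<\rho\le1$, $T_0:=\frac{\rho}{\lambda_{\min}(AA^* )(2-\rho)^2}$ if $1<\rho<2$; (iii) $\mu_1:=\sup_{k\ge0}\|\mathbf{M}_1^k\|<+\infty$ and $\mu_2:=\sup_{k\ge0}\|\mathbf{M}_2^k\|<+\infty$; (iv) $r>0$, $\rho\in(0,2)$ and $\mu_1\ge0$ are such that $r\ge4T_0L>0$ and $2\mathbf{M}_1^k+rA^*A\succcurlyeq\big(L+\frac{C_{\mathbf M}'}{r}\big)\mathrm{Id}$ for all $k\ge0$, where $C_{\mathbf M}':=(10\mu_1^2+8(L+\mu_1)^2)T_0$ for Algorithm 1 and $C_{\mathbf M}':=(8\mu_1^2+10(L+\mu_1)^2)T_0$ for Algorithm 2. Regularized augmented Lagrangian. $\mathcal{F}_r(x,z,y,x',y')=\mathcal{L}_r(x,z,y)+2T_1\|A^*(y-y')\|^2+C_1\|x-x'\|^2$ on $\mathbb{R}^n\times\mathbb{R}^m\times\mathbb{R}^m\times\mathbb{R}^n\times\mathbb{R}^m$, where $T_1:=\frac{1-\rho}{\lambda_{\min}(AA^* )\rho^2r}$ if $0<\rho\le1$, $T_1:=\frac{\rho-1}{\lambda_{\min}(AA^*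 )(2-\rho)\rho r}$ if $1<\rho<2$, and $C_1:=\frac{4T_0\mu_1^2}{r}$ for Algorithm 1, $C_1:=\frac{4T_0(L+\mu_1)^2}{r}$ for Algorithm 2. Put $\mathcal{F}_k:=\mathcal{F}_r(x^k,z^k,y^k,x^{k-1},y^{k-1})$ for $k\ge1$; in this setting the limit $\mathcal{F}_*:=\lim_k\mathcal{F}_k\in\mathbb{R}$ exists. Łojasiewicz property. A proper lower semicontinuous $\Psi$ satisfies the Łojasiewicz property if for any critical point $\widehat u$ of $\Psi$ (i.e. $0\in\partial\Psi(\widehat u)$) there exist $C_L>0$, $\theta\in[0,1)$, $\varepsilon>0$ with $|\Psi(u)-\Psi(\widehat u)|^\theta\le C_L\,\mathrm{dist}(0,\partial\Psi(u))$ for all $u$ in the open ball of radius $\varepsilon$ around $\widehat u$ (with the convention $0^0=0$). If $\mathcal{F}_r$ satisfies it, then $\{(x^k,z^k,y^k)\}$ converges to some KKT point $(\widehat x,\widehat z,\widehat y)$ and there exist $C_L>0$, $\theta\in[0,1)$, $\varepsilon>0$ with $|\mathcal{F}_r(u)-\mathcal{F}_*|^\theta\le C_L\,\mathrm{dist}(0,\partial\mathcal{F}_r(u))$ for all $u$ in the open ball of radius $\varepsilon$ around $(\widehat x,\widehat z,\widehat y,\widehat x,\widehat y)$; $\mathcal{F}_r$ is then said to satisfy the Łojasiewicz property with Łojasiewicz constant $C_L$ and Łojasiewicz exponent $\theta$. *)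

(* Defs.v *)
From HB Require Import structures.
From mathcomp Require Import all_boot all_order all_algebra.
From mathcomp Require Import all_classical all_reals all_analysis.

Set Implicit Arguments.
Unset Strict Implicit.
Unset Printing Implicit Defensive.

Import Order.TTheory GRing.Theory Num.Theory.
Import numFieldNormedType.Exports.

Local Open Scope classical_set_scope.
Local Open Scope ring_scope.

(* The library norm of 'cV[R]_N is the sup norm. It is used below only through
   the topology and the notion of differentiability it induces, which are the
   Euclidean ones; every quantitative statement uses enorm. *)
Definition dot (R : realType) (N : nat) (u v : 'cV[R]_N) : R :=
  \sum_i u i 0 * v i 0.

Definition enorm (R : realType) (N : nat) (u : 'cV[R]_N) : R :=
  Num.sqrt (dot u u).

Definition wnorm2 (R : realType) (N : nat) (M : 'M[R]_N) (u : 'cV[R]_N) : R :=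
  dot (M *m u) u.

Definition loewner_ge (R : realType) (N : nat) (M M' : 'M[R]_N) : Prop :=
  forall u : 'cV[R]_N, wnorm2 M' u <= wnorm2 M u.

Definition sym_psd (R : realType) (N : nat) (M : 'M[R]_N) : Prop :=
  M^T = M /\ loewner_ge M 0.

Definition opnorm (R : realType) (N : nat) (M : 'M[R]_N) : R :=
  sup [set enorm (M *m u) | u in [set u : 'cV[R]_N | enorm u <= 1]].

(* The eigenvalues of a symmetric matrix of positive size form a nonempty
   finite set of reals, so that the infimum is the smallest of them. *)
Definition lambda_min (R : realType) (N : nat) (M : 'M[R]_N) : R :=
  inf [set a : R | eigenvalue M a].

(* sup_k ||M_k||; meaningful when these norms are bounded above. *)
Definition sup_opnorm (R : realType) (N : nat) (M : nat -> 'M[R]_N) : R :=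
  sup (range (fun k => opnorm (M k))).

(* The vector representing the Frechet derivative of h at x. *)
Definition gradient (R : realType) (N : nat) (h : 'cV[R]_N -> R)
    (x : 'cV[R]_N) : 'cV[R]_N :=
  \col_i ('d h x (delta_mx i 0) : R).

Definition argmin (V : Type) (d : Order.disp_t) (T : porderType d)
    (f : V -> T) : set V :=
  [set u | forall v, (f u <= f v)%O].

(* Functions with values in R \cup {+oo} are functions to \bar R that avoid
   -oo; this is part of properness. *)
Definition proper_fun (R : realType) (N : nat) (f : 'cV[R]_N -> \bar R) : Prop :=
  (forall u, f u != -oo%E) /\ (exists u, f u != +oo%E).

Definition frechet_subdiff (R : realType) (N : nat) (f : 'cV[R]_N -> \bar R)
    (u : 'cV[R]_N) : set 'cV[R]_N :=
  [set d | (f u < +oo)%E /\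
    (0 <= limf_einf
      (fun v => (f v - f u - (dot d (v - u))%:E) * ((enorm (v - u))^-1)%:E)
      u^')%E].

Definition limiting_subdiff (R : realType) (N : nat) (f : 'cV[R]_N -> \bar R)
    (u : 'cV[R]_N) : set 'cV[R]_N :=
  [set d | (f u < +oo)%E /\
    exists (us ds : nat -> 'cV[R]_N),
      [/\ us @ \oo --> u,
          ds @ \oo --> d,
          (f \o us) @ \oo --> f u &
          forall k, frechet_subdiff f (us k) (ds k)]].

Definition edist_set (R : realType) (N : nat) (u : 'cV[R]_N)
    (S : set 'cV[R]_N) : \bar R :=
  ereal_inf [set (enorm (u - v))%:E | v in S].

(* a `^ theta for a >= 0, with 0^0 = 0, whereas the library has 0 `^ 0 = 1. *)
Definition pow00 (R : realType) (a : \bar R) (theta : R) : \bar R :=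
  if (a == 0)%E then 0%E else (a `^ theta)%E.

(* The Lojasiewicz inequality around u, relative to the value c. *)
Definition lojasiewicz_at (R : realType) (N : nat) (f : 'cV[R]_N -> \bar R)
    (u : 'cV[R]_N) (c : \bar R) (CL theta : R) : Prop :=
  exists eps : R, 0 < eps /\
    forall v : 'cV[R]_N, enorm (v - u) < eps ->
      (pow00 `|f v - c| theta
        <= CL%:E * edist_set 0%R (limiting_subdiff f v))%E.

Definition lojasiewicz_property (R : realType) (N : nat)
    (f : 'cV[R]_N -> \bar R) : Prop :=
  forall u : 'cV[R]_N, limiting_subdiff f u 0 ->
    exists CL theta : R,
      [/\ 0 < CL, 0 <= theta < 1 & lojasiewicz_at f u (f u) CL theta].

Definition is_KKT (R : realType) (m n : nat) (g : 'cV[R]_m -> \bar R)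
    (h : 'cV[R]_n -> R) (A : 'M[R]_(m, n))
    (x : 'cV[R]_n) (z y : 'cV[R]_m) : Prop :=
  [/\ - (A^T *m y) = gradient h x, limiting_subdiff g z y & z = A *m x].

(* The x-step of Algorithm2 linearizes h. *)
Variant algorithm := Algorithm1 | Algorithm2.

Definition z_objective (R : realType) (m n : nat) (g : 'cV[R]_m -> \bar R)
    (A : 'M[R]_(m, n)) (r : R) (M2k : 'M[R]_m)
    (xk : 'cV[R]_n) (zk yk : 'cV[R]_m) (z : 'cV[R]_m) : \bar R :=
  (g z + (dot yk (A *m xk - z) + r / 2 * enorm (A *m xk - z) ^+ 2
          + 1 / 2 * wnorm2 M2k (z - zk))%:E)%E.

Definition x_objective (R : realType) (m n : nat) (alg : algorithm)
    (h : 'cV[R]_n -> R) (A : 'M[R]_(m, n)) (r : R) (M1k : 'M[R]_n)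
    (xk : 'cV[R]_n) (zk1 yk : 'cV[R]_m) (x : 'cV[R]_n) : R :=
  match alg with
  | Algorithm1 => h x
  | Algorithm2 => dot (x - xk) (gradient h xk)
  end
  + dot yk (A *m x - zk1) + r / 2 * enorm (A *m x - zk1) ^+ 2
  + 1 / 2 * wnorm2 M1k (x - xk).

Definition generated_by (R : realType) (m n : nat) (alg : algorithm)
    (g : 'cV[R]_m -> \bar R) (h : 'cV[R]_n -> R) (A : 'M[R]_(m, n))
    (M1 : nat -> 'M[R]_n) (M2 : nat -> 'M[R]_m) (r rho : R)
    (x : nat -> 'cV[R]_n) (z y : nat -> 'cV[R]_m) : Prop :=
  forall k : nat,
    [/\ argmin (z_objective g A r (M2 k) (x k) (z k) (y k)) (z k.+1),
        argmin (x_objective alg h A r (M1 k) (x k) (z k.+1) (y k)) (x k.+1) &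
        y k.+1 = y k + (rho * r) *: (A *m x k.+1 - z k.+1)].

Definition T0 (R : realType) (m n : nat) (A : 'M[R]_(m, n)) (rho : R) : R :=
  if rho <= 1 then 1 / (lambda_min (A *m A^T) * rho)
  else rho / (lambda_min (A *m A^T) * (2 - rho) ^+ 2).

Definition T1 (R : realType) (m n : nat) (A : 'M[R]_(m, n)) (r rho : R) : R :=
  if rho <= 1 then (1 - rho) / (lambda_min (A *m A^T) * rho ^+ 2 * r)
  else (rho - 1) / (lambda_min (A *m A^T) * (2 - rho) * rho * r).

Definition CM' (R : realType) (m n : nat) (alg : algorithm)
    (A : 'M[R]_(m, n)) (rho L mu1 : R) : R :=
  match alg with
  | Algorithm1 => (10 * mu1 ^+ 2 + 8 * (L + mu1) ^+ 2) * T0 A rho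
  | Algorithm2 => (8 * mu1 ^+ 2 + 10 * (L + mu1) ^+ 2) * T0 A rho
  end.

Definition C1 (R : realType) (m n : nat) (alg : algorithm)
    (A : 'M[R]_(m, n)) (r rho L mu1 : R) : R :=
  match alg with
  | Algorithm1 => 4 * T0 A rho * mu1 ^+ 2 / r
  | Algorithm2 => 4 * T0 A rho * (L + mu1) ^+ 2 / r
  end.

Record assumptionA' (R : realType) (m n : nat) (alg : algorithm)
    (g : 'cV[R]_m -> \bar R) (h : 'cV[R]_n -> R) (L : R) (A : 'M[R]_(m, n))
    (M1 : nat -> 'M[R]_n) (M2 : nat -> 'M[R]_m) (r rho : R) : Prop := {
  A'_g_bounded_below : exists c : R, forall z, (c%:E <= g z)%E;
  A'_h_bounded_below : exists c : R, forall x, c <= h x;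
  A'_surjective : forall w : 'cV[R]_m, exists x : 'cV[R]_n, A *m x = w;
  A'_M1_bounded : has_ubound (range (fun k => opnorm (M1 k)));
  A'_M2_bounded : has_ubound (range (fun k => opnorm (M2 k)));
  A'_r_ge : 4 * T0 A rho * L <= r;
  A'_T0L_gt0 : 0 < 4 * T0 A rho * L;
  A'_loewner : forall k,
    loewner_ge (2 *: M1 k + r *: (A^T *m A))
               (L + CM' alg A rho L (sup_opnorm M1) / r)%:M
}.

Definition augL (R : realType) (m n : nat) (g : 'cV[R]_m -> \bar R)
    (h : 'cV[R]_n -> R) (A : 'M[R]_(m, n)) (r : R)
    (x : 'cV[R]_n) (z y : 'cV[R]_m) : \bar R :=
  (g z + (h x + dot y (A *m x - z) + r / 2 * enorm (A *m x - z) ^+ 2)%:E)%E.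

Definition regL (R : realType) (m n : nat) (alg : algorithm)
    (g : 'cV[R]_m -> \bar R) (h : 'cV[R]_n -> R) (L : R) (A : 'M[R]_(m, n))
    (mu1 r rho : R)
    (x : 'cV[R]_n) (z y : 'cV[R]_m) (x' : 'cV[R]_n) (y' : 'cV[R]_m) : \bar R :=
  (augL g h A r x z y
   + (2 * T1 A r rho * enorm (A^T *m (y - y')) ^+ 2
      + C1 alg A r rho L mu1 * enorm (x - x') ^+ 2)%:E)%E.

(* The product R^n x R^m x R^m x R^n x R^m is realized by stacking columns, so
   that enorm and dot restrict to the Euclidean structure of the product. *)
Definition stack5 (R : realType) (m n : nat) (x : 'cV[R]_n) (z y : 'cV[R]_m)
    (x' : 'cV[R]_n) (y' : 'cV[R]_m) : 'cV[R]_(n + (m + (m + (n + m)))) :=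
  col_mx x (col_mx z (col_mx y (col_mx x' y'))).

Definition on_stack5 (R : realType) (m n : nat) (T : Type)
    (F : 'cV[R]_n -> 'cV[R]_m -> 'cV[R]_m -> 'cV[R]_n -> 'cV[R]_m -> T)
    (u : 'cV[R]_(n + (m + (m + (n + m)))) ) : T :=
  let u1 := dsubmx u in
  let u2 := dsubmx u1 in
  let u3 := dsubmx u2 in
  F (usubmx u) (usubmx u1) (usubmx u2) (usubmx u3) (dsubmx u3).

(* Main.v *)
Require Import Defs.
From HB Require Import structures.
From mathcomp Require Import all_boot all_order all_algebra.
From mathcomp Require Import all_classical all_reals all_analysis.
From mathcomp Require Import ring lra zify.

Set Implicit Arguments.
Unset Strict Implicit.
Unset Printing Implicit Defensive.

Import Order.TTheory GRing.Theory Num.Theory.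
Import numFieldNormedType.Exports.

Local Open Scope classical_set_scope.
Local Open Scope ring_scope.

(** Let E k be the gap between the value of the regularized augmented
Lagrangian at the (k+1)-st iterate and its limit, and let a k be the sum of the
lengths of the k-th steps of x and y. Three facts drive the proof.

- Sufficient decrease: a (k+1) ^ 2 <= C (E k - E (k+1))
  (sufficient_decrease, steplen_sqr). The z-update and the x-update decrease the
  augmented Lagrangian, the y-update increases it by |dy|^2 / (rho r). The
  optimality condition of the x-update says that A^T y relaxes towards a vector
  depending only on the x-iterates (dual_recursion). Since A A^T is positive
  definite, this bounds |dy| by the steps of x, up to a telescoping term in
  |A^T dy|^2, which is exactly what the regularization absorbs. The matrix
  inequality of the assumption pays for the rest.

- Small subgradients: at the point with gap E (k+1) some subgradient has norm at
  most C (a (k+1) + a k) (frechet_subgrad, subgrad_bound). The vector is the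
  gradient of the smooth part, completed in z by the optimality condition of
  the z-update. As z minimizes g plus a quadratic, and the gradient of h is
  Lipschitz, the function minus its linear part is bounded below by a quadratic
  at the iterate, so the vector is even a Frechet subgradient and no limiting
  procedure is needed.

- The Lojasiewicz inequality at the limit point then reads
  E (k+1) ^ theta <= C (a (k+1) + a k) for large k (iterate_KL).

The rest concerns real sequences. By concavity of s ^ (1 - theta) the first and
third fact give a (j+1) <= P j - P (j+1) for the potential P of KL_potential,
so the distance of an iterate to the limit is at most P, and for theta >= 1/2
this is at most a multiple of E ^ (1 - theta) (error_bound). When theta < 1/2
the exponent may be raised to 1/2, because E is eventually at most 1. Finally
(E (k+2) ^ theta) ^ 2 <= C (E k - E (k+2)), which forces E to decay
geometrically for theta <= 1/2 (two_step_linear) and like a power of k for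
theta > 1/2 (two_step_sublinear); for theta = 0 the inequality
1 <= C (a (k+1) + a k) cannot hold for large k, so E vanishes from some index
on. *)

(** * Real sequences under a Lojasiewicz inequality *)

Section Rates.
Context {R : realType}.
Implicit Types (s t theta C : R) (E a w : nat -> R).

(** Weighted Young inequality, written with the exponents that occur in
[powR_concave]. *)
Lemma powR_young s t theta : 0 <= s -> 0 <= t -> 0 < theta < 1 ->
  s `^ theta * t `^ (1 - theta) <= theta * s + (1 - theta) * t.
Proof.
move=> s0 t0 /andP[th0 th1].
have th'0 : 0 < 1 - theta by rewrite subr_gt0.
have := @conjugate_powR R (s `^ theta) (t `^ (1 - theta)) theta^-1
  (1 - theta)^-1 (powR_ge0 _ _) (powR_ge0 _ _).
rewrite !invr_gt0 => /(_ th0 th'0); rewrite !invrK subrKC => /(_ erefl).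
rewrite -!powRrM !divff ?gt_eqF// !powRr1// => /le_trans; apply.
by rewrite mulrC lerD2l mulrC.
Qed.

(** Concavity of the desingularizing function t ^ (1 - theta), multiplied by s ^
theta so that it also makes sense at s = 0. *)
Lemma powR_concave s t theta : 0 <= s -> 0 <= t -> 0 < theta < 1 ->
  (1 - theta) * (s - t) <= s `^ theta * (s `^ (1 - theta) - t `^ (1 - theta)).
Proof.
move=> s0 t0 th.
rewrite [X in _ <= X]mulrBr -powRD subrKC ?oner_eq0// powRr1//.
have := powR_young s0 t0 th; lra.
Qed.

(** The bound c <= sqrt (b d) <= b / 4 + d; the weight 1/4 is small enough for
the terms b to be absorbed when these bounds are summed, see
[KL_potential_step]. *)
Lemma sqr_le_mul_le (c b d : R) : 0 <= b -> 0 <= d ->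
  c ^+ 2 <= b * d -> c <= b / 4 + d.
Proof.
move=> b0 d0 cbd.
have h : c ^+ 2 <= (b / 4 + d) ^+ 2.
  apply: le_trans cbd _; have := sqr_ge0 (b / 4 - d); lra.
rewrite leNgt; apply/negP => lt.
have : (b / 4 + d) ^+ 2 < c ^+ 2 by rewrite ltr_pXn2r ?nnegrE//; lra.
by rewrite ltNge h.
Qed.

(** The potential whose decrease dominates the steps. Besides the desingularized
value it carries the last two steps, because the subgradient bound at one
iterate involves the steps of two iterations. *)
Definition KL_potential theta C E a k : R :=
  2 * (C ^+ 2 / (1 - theta)) * E k `^ (1 - theta) + a k + a k.-1 / 2.

Section Tail.
Variables (theta C : R) (E a : nat -> R) (K : nat).
Hypotheses (th_ge : 1 / 2 <= theta) (th_lt : theta < 1) (C1 : 1 <= C).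
Hypotheses (E0 : forall k, (K <= k)%N -> 0 <= E k <= 1).
Hypotheses (a0 : forall k, 0 <= a k).
Hypothesis dec : forall k, (K <= k)%N -> a k.+1 ^+ 2 <= C * (E k - E k.+1).
Hypothesis KL : forall k, (K <= k)%N -> E k.+1 `^ theta <= C * (a k.+1 + a k).

Let Psi := KL_potential theta C E a.

Lemma KL_nonincr k : (K <= k)%N -> E k.+1 <= E k.
Proof.
move=> Kk; rewrite -subr_ge0 -(pmulr_rge0 _ (lt_le_trans ltr01 C1)).
exact: le_trans (sqr_ge0 _) (dec Kk).
Qed.

Lemma KL_potential_ge k : a k <= Psi k.
Proof.
rewrite /Psi /KL_potential.
have ? : 0 <= 2 * (C ^+ 2 / (1 - theta)) * E k `^ (1 - theta).
  rewrite mulr_ge0 ?powR_ge0// mulr_ge0// divr_ge0 ?sqr_ge0//.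
  by rewrite subr_ge0 ltW.
have := a0 k.-1; lra.
Qed.

(** This telescopes, so the path length after an index is at most the potential
there. With s, t consecutive values and b the sum of the two previous steps,
concavity and the Lojasiewicz inequality give (a_{k+2})^2 <= C (s - t) <= b *
const (s^(1-theta) - t^(1-theta)); then [sqr_le_mul_le] applies. *)
Lemma KL_potential_step k : (K <= k)%N -> a k.+2 <= Psi k.+1 - Psi k.+2.
Proof.
move: th_ge th_lt => th1 th2 Kk; rewrite /Psi /KL_potential /=.
have Kk1 : (K <= k.+1)%N by apply: leqW.
have [/andP[s0 _] /andP[t0 _]] := (E0 Kk1, E0 (leqW Kk1)).
have th' : 0 < theta < 1 by rewrite th_lt andbT; lra.
set s := E k.+1 in s0 *; set t := E k.+2 in t0 *.
set d := s `^ (1 - theta) - t `^ (1 - theta).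
have d0 : 0 <= d.
  rewrite subr_ge0 ge0_ler_powR ?nnegrE//; last exact: KL_nonincr.
  lra.
have th'1 : 0 < 1 - theta by lra.
have h : a k.+2 ^+ 2 <= (a k.+1 + a k) * (C ^+ 2 / (1 - theta) * d).
  apply: le_trans (dec Kk1) _; rewrite -/s -/t.
  have /ler_wpM2r -/(_ _ d0) := KL Kk; rewrite -/s => h1.
  have h2 := le_trans (powR_concave s0 t0 th') h1.
  have : s - t <= (C * (a k.+1 + a k) * d) / (1 - theta).
    by rewrite ler_pdivlMr// mulrC.
  move=> /(ler_wpM2l (le_trans ler01 C1)) /le_trans; apply.
  by rewrite le_eqVlt; apply/orP; left; apply/eqP; ring.
have d'0 : 0 <= C ^+ 2 / (1 - theta) * d.
  by rewrite mulr_ge0// divr_ge0 ?sqr_ge0// ltW.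
have := sqr_le_mul_le (addr_ge0 (a0 _) (a0 _)) d'0 h.
rewrite /d; lra.
Qed.

(** A step is bounded by the square root of the value before it, and for theta
>= 1/2 and values in [0, 1] the square root is at most the power 1 - theta;
hence the whole potential is governed by the value two indices earlier. *)
Lemma KL_potential_le k : (K <= k)%N ->
  Psi k.+2 <= (2 * (C ^+ 2 / (1 - theta)) + 2 * C) * E k `^ (1 - theta).
Proof.
move: th_ge th_lt => th1 th2 Kk.
have Kk1 : (K <= k.+1)%N by apply: leqW.
have Kk2 := leqW Kk1.
have [/andP[E00 E01] /andP[E10 E11] /andP[E20 _]] :=
  And3 (E0 Kk) (E0 Kk1) (E0 Kk2).
have le10 := KL_nonincr Kk; have le21 := KL_nonincr Kk1.
set w := E k `^ (1 - theta).
have w0 : 0 <= w by exact: powR_ge0.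
have Ew : E k <= w ^+ 2.
  rewrite -powR_mulrn// -powRrM.
  have [->|n0] := eqVneq (E k) 0; first exact: powR_ge0.
  by apply: ger1_powR; [rewrite lt_def n0 E00|lra].
have C0 : 0 <= C by apply: le_trans C1.
have aw b : b ^+ 2 <= C * E k -> b <= C * w.
  move=> h; have {}h : b ^+ 2 <= (C * w) ^+ 2.
    apply: le_trans h _; rewrite exprMn.
    by apply: ler_pM => //; rewrite expr2 ler_peMl.
  rewrite leNgt; apply/negP => lt.
  have : (C * w) ^+ 2 < b ^+ 2.
    by rewrite ltr_pXn2r ?nnegrE ?mulr_ge0//; apply: ltW;
      apply: le_lt_trans lt; rewrite mulr_ge0.
  by rewrite ltNge h.
have a2 : a k.+2 <= C * w.
  apply: aw; apply: le_trans (dec Kk1) _; apply: ler_wpM2l => //; lra.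
have a1 : a k.+1 <= C * w.
  apply: aw; apply: le_trans (dec Kk) _; apply: ler_wpM2l => //; lra.
have Ep : E k.+2 `^ (1 - theta) <= w.
  rewrite ge0_ler_powR ?nnegrE//; lra.
have : 0 <= 2 * (C ^+ 2 / (1 - theta)).
  by rewrite mulr_ge0// divr_ge0 ?sqr_ge0//; lra.
move=> /ler_wpM2l /(_ _ _ Ep) h.
rewrite /Psi /KL_potential /=; have := a0 k.+1; lra.
Qed.

Lemma two_steps_le k : (K <= k)%N ->
  (C * (a k.+2 + a k.+1)) ^+ 2 <= 2 * C ^+ 3 * (E k - E k.+2).
Proof.
move=> Kk; have Kk1 : (K <= k.+1)%N by apply: leqW.
rewrite exprMn.
have -> : 2 * C ^+ 3 * (E k - E k.+2)
    = C ^+ 2 * (2 * (C * (E k - E k.+1) + C * (E k.+1 - E k.+2))) by ring.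
apply: ler_wpM2l; first exact: sqr_ge0.
have := dec Kk; have := dec Kk1; have := sqr_ge0 (a k.+2 - a k.+1); lra.
Qed.

Lemma KL_value_step k : (K <= k)%N ->
  (E k.+2 `^ theta) ^+ 2 <= 2 * C ^+ 3 * (E k - E k.+2).
Proof.
move=> Kk; have Kk1 : (K <= k.+1)%N by apply: leqW.
apply: le_trans (two_steps_le Kk).
have C0 : 0 <= C by apply: le_trans C1.
rewrite ler_pXn2r ?nnegrE ?powR_ge0//; first exact: KL.
by rewrite mulr_ge0// addr_ge0.
Qed.

End Tail.

(** Here E (k+2) <= q E k with q = C / (1 + C) < 1. The bound is stated as a
square since it is the square root of E that bounds the distances; this is why a
fourth root of q appears. *)
Lemma two_step_linear E C K : 0 < C ->
  (forall k, (K <= k)%N -> 0 <= E k) ->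
  (forall k, (K <= k)%N -> E k.+2 <= C * (E k - E k.+2)) ->
  exists D Q : R, [/\ 0 < D, 0 < Q < 1 &
    forall k, (K <= k)%N -> E k <= (D * Q ^+ k) ^+ 2].
Proof.
move=> C0 E0 rec.
pose q := C / (1 + C).
have q0 : 0 < q by rewrite divr_gt0//; lra.
have q1 : q < 1 by rewrite ltr_pdivrMr; lra.
pose Q := Num.sqrt (Num.sqrt q).
have Q0 : 0 < Q by rewrite !sqrtr_gt0.
have Q4 : Q ^+ 4 = q.
  by rewrite (_ : 4 = 2 * 2)%N// exprM !sqr_sqrtr ?sqrtr_ge0// ltW.
have Q1 : Q < 1.
  by rewrite ltNge; apply/negP => /(exprn_ege1 4); rewrite Q4 leNgt q1.
have step k : (K <= k)%N -> E k.+2 <= Q ^+ 4 * E k.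
  move=> Kk; rewrite Q4 /q -(ler_pM2l (_ : 0 < 1 + C)); last lra.
  rewrite mulrA [X in X * E k]mulrC divfK; last (by rewrite gt_eqF// addr_gt0).
  have := rec _ Kk; lra.
pose D := Num.max 1 (Num.max (E K / (Q ^+ K) ^+ 2) (E K.+1 / (Q ^+ K.+1) ^+ 2)).
have D1 : 1 <= D by rewrite le_max lexx.
have DD k : (Q ^+ k) ^+ 2 * D <= (D * Q ^+ k) ^+ 2.
  rewrite exprMn mulrC; apply: ler_wpM2r; first exact: sqr_ge0.
  by rewrite expr2; nra.
exists D, Q; split => [||k]; [exact: lt_le_trans D1|by rewrite Q0|].
suff H i : E (K + i)%N <= (Q ^+ (K + i)) ^+ 2 * D /\
           E (K + i).+1 <= (Q ^+ (K + i).+1) ^+ 2 * D.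
  by move=> /subnKC <-; case: (H (k - K)%N) => h _; apply: le_trans h (DD _).
elim: i => [|i [IH1 IH2]].
  rewrite addn0 -!ler_pdivrMl ?exprn_gt0//; split;
    by rewrite mulrC !le_max lexx ?orbT.
rewrite addnS; split=> //; apply: le_trans (step _ (leq_addr _ _)) _.
apply: le_trans (ler_wpM2l _ IH1) _; first by rewrite exprn_ge0// ltW.
rewrite mulrA -!exprM -exprD (_ : 4 + _ = (K + i).+2 * 2)%N//; lia.
Qed.

(** The discrete form of w' <= - beta w^2: over two indices 1 / w increases by
at least a fixed amount. The induction compares w with D / (k+1) directly and so
never divides by w. *)
Lemma two_step_inverse w beta K : 0 < beta ->
  (forall k, (K <= k)%N -> 0 <= w k) ->
  (forall k, (K <= k)%N -> w k.+2 * (1 + beta * w k.+2) <= w k) ->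
  exists2 D : R, 0 < D & forall k, (K <= k)%N -> w k <= D / k.+1%:R.
Proof.
move=> b0 w0 rec.
(* 6 = 2 * 3, as (j+3) / (j+1) <= 3 *)
pose D := Num.max (6 / beta) (Num.max (w K * K.+1%:R) (w K.+1 * K.+2%:R)).
have D6 : 6 / beta <= D by rewrite le_max lexx.
have D0 : 0 < D by apply: lt_le_trans D6; rewrite divr_gt0.
exists D => // k.
suff H i : w (K + i)%N <= D / (K + i).+1%:R /\
           w (K + i).+1 <= D / (K + i).+2%:R.
  by move=> /subnKC <-; case: (H (k - K)%N).
elim: i => [|i [IH1 IH2]].
  by rewrite addn0 !ler_pdivlMr ?ltr0n//; split; rewrite !le_max lexx ?orbT.
rewrite addnS; split=> //; set j := (K + i)%N in IH1 IH2 *.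
have := rec j (leq_addr _ _) => /le_trans /(_ IH1) h.
rewrite leNgt; apply/negP => lt.
set u := w j.+2 in h lt.
have j1 : 1 <= j.+1%:R :> R by rewrite ler1n.
set N : R := j.+1%:R in j1 h *.
have EN : j.+3%:R = N + 2 by rewrite /N -natrD addn2.
rewrite {}EN in lt.
have N0 : 0 < N by lra.
have N20 : 0 < N + 2 by lra.
move: h; rewrite ler_pdivlMr// => h.
move: lt; rewrite ltr_pdivrMr// => lt.
have u0 : 0 <= u by apply: w0; rewrite /j; lia.
have bD : 6 <= beta * D by rewrite mulrC -ler_pdivrMr.
have bu : 6 <= beta * u * (N + 2).
  rewrite (le_trans bD)// -mulrA ler_pM2l//; lra.
have bN : 2 <= beta * u * N.
  have : 0 <= beta * u by rewrite mulr_ge0// ltW.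
  nra.
have : u * (N + 2) <= D.
  apply: le_trans h; rewrite -mulrA ler_wpM2l//.
  rewrite mulrDl mul1r; lra.
lra.
Qed.

(** Follows from (1 + s)^alpha = exp (alpha ln (1 + s)) and ln (1 + s) >= s / (1
+ s). *)
Lemma powR_1D_ge (s alpha : R) : 0 <= s <= 1 -> 0 <= alpha ->
  1 + alpha / 2 * s <= (1 + s) `^ alpha.
Proof.
move=> /andP[s0 s1] al0.
have s10 : 0 < 1 + s by lra.
rewrite /powR gt_eqF//; apply: le_trans (expR_ge1Dx _).
rewrite lerD2l -mulrA ler_wpM2l//.
have := @le_ln1Dx R (- (s / (1 + s))).
have h : s / (1 + s) < 1 by rewrite ltr_pdivrMr//; lra.
rewrite ltrN2 => /(_ h).
have -> : 1 - s / (1 + s) = (1 + s)^-1 by field; rewrite gt_eqF.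
rewrite lnV ?posrE// lerN2; apply: le_trans.
by rewrite mulrC ler_wpM2l// ler_pV2 ?inE ?unitfE ?gt_eqF//; lra.
Qed.

(** With alpha = 2 theta - 1 the hypothesis reads t (1 + t^alpha / C) <= s for
values s, t two indices apart. Raising it to the power alpha turns it into the
quadratic recursion of [two_step_inverse] for E^alpha. *)
Lemma two_step_sublinear theta E C K : 1 / 2 < theta < 1 -> 1 <= C ->
  (forall k, (K <= k)%N -> 0 <= E k <= 1) ->
  (forall k, (K <= k)%N -> (E k.+2 `^ theta) ^+ 2 <= C * (E k - E k.+2)) ->
  exists2 D : R, 0 < D &
    forall k, (K <= k)%N ->
      E k `^ (1 - theta) <= D * k.+1%:R `^ (- ((1 - theta) / (2 * theta - 1))).
Proof.
move=> /andP[th1 th2] C1 E01 rec.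
pose alpha := 2 * theta - 1.
have al0 : 0 < alpha by rewrite /alpha; lra.
have C0 : 0 < C by apply: lt_le_trans C1.
have beta0 : 0 < alpha / 2 / C by rewrite !divr_gt0.
have step k : (K <= k)%N ->
    E k.+2 `^ alpha * (1 + alpha / 2 / C * E k.+2 `^ alpha) <= E k `^ alpha.
  move=> Kk.
  have /andP[s0 s1] := E01 _ Kk.
  have /andP[t0 t1] := E01 _ (leqW (leqW Kk)).
  set s := E k in s0 s1 *; set t := E k.+2 in t0 t1 *.
  set w := t `^ alpha.
  have w0 : 0 <= w by exact: powR_ge0.
  have w1 : w <= 1.
    have := @ge0_ler_powR _ alpha (ltW al0) t 1; rewrite powR1 !nnegrE; exact.
  have h : t * (1 + w / C) <= s.
    have := rec _ Kk; rewrite -/s -/t -powR_mulrn ?powR_ge0// -powRrM.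
    have -> : theta * 2%:R = 1 + alpha by rewrite /alpha; ring.
    rewrite powRD; last by rewrite gt_eqF// addr_gt0.
    rewrite powRr1// -/w => h.
    have : t * w / C <= s - t by rewrite ler_pdivrMr// [X in _ <= X]mulrC.
    lra.
  have w1C : 0 <= w / C <= 1.
    by rewrite divr_ge0 ?(ltW C0)//= ler_pdivrMr// mul1r (le_trans w1).
  have := powR_1D_ge w1C (ltW al0) => h1.
  have : (t * (1 + w / C)) `^ alpha <= s `^ alpha.
    rewrite ge0_ler_powR ?nnegrE ?mulr_ge0//; lra.
  apply: le_trans; rewrite powRM//; last lra.
  rewrite -/w ler_wpM2l//; apply: le_trans h1.
  by rewrite le_eqVlt; apply/orP; left; apply/eqP; ring.
have [D D0 HD] := @two_step_inverse (fun k => E k `^ alpha) _ K beta0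
  (fun k _ => powR_ge0 (E k) alpha) step.
pose gamma := (1 - theta) / alpha.
have g0 : 0 <= gamma by rewrite divr_ge0//; lra.
exists (D `^ gamma); first exact: powR_gt0.
move=> k Kk; rewrite -/alpha -/gamma.
have -> : 1 - theta = alpha * gamma.
  by rewrite mulrC divfK// gt_eqF.
have -> : D `^ gamma * k.+1%:R `^ (- gamma) = (D / k.+1%:R) `^ gamma.
  by rewrite powRM ?invr_ge0 ?(ltW D0)// -(powR_inv1 (ler0n _ _)) -powRrM mulN1r.
rewrite powRrM.
apply: ge0_ler_powR => //; rewrite ?nnegrE; last exact: HD.
  exact: powR_ge0.
by rewrite divr_ge0 // ltW.
Qed.

End Rates.

(** * Euclidean vectors and symmetric matrices *)

Section Euclid.
Context {R : realType}.

Section Dot.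
Context {N : nat}.
Implicit Types (u v w : 'cV[R]_N) (c : R).

Lemma dotC u v : dot u v = dot v u.
Proof. by apply: eq_bigr => i _; rewrite mulrC. Qed.

Lemma dotDl u v w : dot (u + v) w = dot u w + dot v w.
Proof. by rewrite -big_split; apply: eq_bigr => i _; rewrite mxE mulrDl. Qed.

Lemma dotZl c u v : dot (c *: u) v = c * dot u v.
Proof. by rewrite /dot mulr_sumr; apply: eq_bigr => i _; rewrite mxE mulrA. Qed.

Lemma dotNl u v : dot (- u) v = - dot u v.
Proof. by rewrite -scaleN1r dotZl mulN1r. Qed.

Lemma dotDr u v w : dot w (u + v) = dot w u + dot w v.
Proof. by rewrite !(dotC w) dotDl. Qed.

Lemma dotZr c u v : dot u (c *: v) = c * dot u v.
Proof. by rewrite !(dotC u) dotZl. Qed.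

Lemma dotNr u v : dot u (- v) = - dot u v.
Proof. by rewrite !(dotC u) dotNl. Qed.

Lemma dot0l u : dot 0 u = 0.
Proof. by rewrite -(scale0r 0) dotZl mul0r. Qed.

Lemma dot0r u : dot u 0 = 0.
Proof. by rewrite dotC dot0l. Qed.

Definition dotE := (dotDl, dotDr, dotNl, dotNr, dotZl, dotZr).

Lemma dot_ge0 u : 0 <= dot u u.
Proof. by apply: sumr_ge0 => i _; rewrite -expr2 sqr_ge0. Qed.

Lemma dot_eq0 u : dot u u = 0 -> u = 0.
Proof.
move=> /eqP; rewrite psumr_eq0 => [/allP h|i _]; last by rewrite -expr2 sqr_ge0.
apply/matrixP => i j; rewrite ord1 mxE; apply/eqP.
have := h i (mem_index_enum i).
by rewrite mulf_eq0 orbb.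
Qed.

Lemma enorm_ge0 u : 0 <= enorm u.
Proof. exact: sqrtr_ge0. Qed.

Lemma sqr_enorm u : enorm u ^+ 2 = dot u u.
Proof. by rewrite sqr_sqrtr// dot_ge0. Qed.

Lemma enorm0 : enorm (0 : 'cV[R]_N) = 0.
Proof. by rewrite /enorm dot0l sqrtr0. Qed.

Lemma enorm_eq0 u : enorm u = 0 -> u = 0.
Proof. by move=> h; apply: dot_eq0; rewrite -sqr_enorm h expr0n. Qed.

Lemma enorm_gt0 u : u != 0 -> 0 < enorm u.
Proof.
by move=> u0; rewrite lt_neqAle enorm_ge0 andbT eq_sym; apply: contra_neq u0;
  exact: enorm_eq0.
Qed.

Lemma dot_gt0 u : u != 0 -> 0 < dot u u.
Proof. by move=> u0; rewrite -sqr_enorm exprn_gt0 ?enorm_gt0. Qed.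

Lemma enormN u : enorm (- u) = enorm u.
Proof. by rewrite /enorm !dotE opprK. Qed.

Lemma enormBC u v : enorm (u - v) = enorm (v - u).
Proof. by rewrite -enormN opprB. Qed.

Lemma enormZ c u : enorm (c *: u) = `|c| * enorm u.
Proof.
by rewrite /enorm !dotE mulrA -expr2 sqrtrM ?sqr_ge0// sqrtr_sqr.
Qed.

Lemma enorm_le u c : 0 <= c -> dot u u <= c ^+ 2 -> enorm u <= c.
Proof.
move=> c0; rewrite -sqr_enorm => h.
by rewrite -(ler_pXn2r (_ : 0 < 2)%N) ?nnegrE ?enorm_ge0.
Qed.

Lemma cauchy_schwarz u v : dot u v <= enorm u * enorm v.
Proof.
have [/enorm_eq0 ->|u0] := eqVneq (enorm u) 0; first by rewrite dot0l enorm0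
  mul0r.
have [/enorm_eq0 ->|v0] := eqVneq (enorm v) 0; first by rewrite dot0r enorm0
  mulr0.
have u1 : 0 < enorm u by rewrite lt_def u0 enorm_ge0.
have v1 : 0 < enorm v by rewrite lt_def v0 enorm_ge0.
have := dot_ge0 (enorm v *: u - enorm u *: v).
rewrite !dotE -!sqr_enorm (dotC v u) => h.
have : 0 < enorm u * enorm v by rewrite mulr_gt0.
set a := enorm u in h u1 *; set b := enorm v in h v1 *;
  set d := dot u v in h * => ab.
rewrite -(ler_pM2l ab) -subr_ge0 -(pmulr_rge0 _ (ltr0Sn _ 1)).
by apply: le_trans h _; rewrite le_eqVlt; apply/orP; left; apply/eqP; ring.
Qed.

Lemma enormD u v : enorm (u + v) <= enorm u + enorm v.
Proof.
apply: enorm_le; first by rewrite addr_ge0 ?enorm_ge0.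
rewrite !dotE (dotC v u) -!sqr_enorm; have := cauchy_schwarz u v; lra.
Qed.

Lemma enormB u v : enorm (u - v) <= enorm u + enorm v.
Proof. by rewrite -(enormN v) enormD. Qed.

Lemma normr_dot u v : `|dot u v| <= enorm u * enorm v.
Proof.
rewrite ler_norml cauchy_schwarz andbT lerNl -dotNl.
by rewrite -(enormN u) cauchy_schwarz.
Qed.

Lemma dot_young u v : - (dot u u + dot v v) / 2 <= dot u v.
Proof. have := dot_ge0 (u + v); rewrite !dotE (dotC v u); lra. Qed.

Lemma dotD_le u v : dot (u + v) (u + v) <= 2 * dot u u + 2 * dot v v.
Proof. have := dot_ge0 (u - v); rewrite !dotE (dotC v u); lra. Qed.

Lemma dot_convex (t : R) u v : 0 <= t <= 1 ->
  dot (t *: u + (1 - t) *: v) (t *: u + (1 - t) *: v)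
    <= t * dot u u + (1 - t) * dot v v.
Proof.
move=> /andP[t0 t1].
have := mulr_ge0 (mulr_ge0 t0 (_ : 0 <= 1 - t)) (dot_ge0 (u - v)).
rewrite subr_ge0 => /(_ t1); rewrite !dotE (dotC v u) => h.
rewrite -subr_ge0; apply: le_trans h _.
by rewrite le_eqVlt; apply/orP; left; apply/eqP; ring.
Qed.

(** Links the sup norm, which defines the topology, to the Euclidean norm. *)
Lemma enorm_le_norm u : enorm u <= (N%:R + 1) * `|u|.
Proof.
apply: enorm_le; first by rewrite mulr_ge0.
apply: (@le_trans _ _ (\sum_(i < N) `|u| ^+ 2)).
  apply: ler_sum => i _; rewrite -expr2 -[_ ^+ 2]ger0_norm ?sqr_ge0// normrX.
  rewrite ler_pXn2r ?nnegrE//.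
  rewrite [leRHS]/Num.Def.normr/= mx_normrE.
  exact: (le_bigmax _ (fun ij : 'I_N * 'I_1 => `|u ij.1 ij.2|) (i, 0)).
rewrite sumr_const card_ord -[leLHS]mulr_natl exprMn ler_wpM2r ?sqr_ge0//.
by rewrite expr2; have := ler0n R N; nra.
Qed.

End Dot.

Lemma enorm_cvg N (x : nat -> 'cV[R]_N) (l : 'cV[R]_N) : x @ \oo --> l ->
  forall e, 0 < e -> exists K, forall k, (K <= k)%N -> enorm (x k - l) < e.
Proof.
move=> /cvgrPdist_lt xl e e0.
have N0 : 0 < N%:R + 1 :> R by rewrite ltr_wpDl.
have /xl[K _ HK] : 0 < e / (N%:R + 1) by rewrite divr_gt0.
exists K => k Kk; have := HK k Kk; rewrite /= ltr_pdivlMr// mulrC => h.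
rewrite enormBC; exact: le_lt_trans (enorm_le_norm _) h.
Qed.

Lemma dot_mulmx m n (A : 'M[R]_(m, n)) u v : dot (A *m u) v = dot u (A^T *m v).
Proof.
rewrite /dot; under eq_bigr do rewrite mxE mulr_suml.
rewrite exchange_big; apply: eq_bigr => j _; rewrite mxE mulr_sumr.
by apply: eq_bigr => i _; rewrite mxE mulrAC mulrC.
Qed.

Lemma dot_col_mx m n (a c : 'cV[R]_m) (b d : 'cV[R]_n) :
  dot (col_mx a b) (col_mx c d) = dot a c + dot b d.
Proof.
rewrite /dot big_split_ord; congr (_ + _); apply: eq_bigr => i _;
  by rewrite ?col_mxEu ?col_mxEd.
Qed.

Lemma mulmx_bounded m n (A : 'M[R]_(m, n)) :
  exists2 K, 0 < K & forall u, enorm (A *m u) <= K * enorm u.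
Proof.
pose S := \sum_i enorm (row i A)^T ^+ 2.
have S0 : 0 <= S by apply: sumr_ge0 => i _; rewrite sqr_ge0.
exists (S + 1) => [|u]; first by lra.
apply: enorm_le; first by rewrite mulr_ge0 ?enorm_ge0//; lra.
apply: (@le_trans _ _ (S * enorm u ^+ 2)); last first.
  by rewrite exprMn ler_wpM2r ?sqr_ge0//; nra.
rewrite mulr_suml; apply: ler_sum => i _.
have -> : (A *m u) i 0 = dot (row i A)^T u.
  by rewrite mxE; apply: eq_bigr => j _; rewrite !mxE.
rewrite -expr2 -exprMn -[_ ^+ 2]ger0_norm ?sqr_ge0// normrX.
by rewrite ler_pXn2r ?nnegrE ?mulr_ge0 ?enorm_ge0 ?normr_dot.
Qed.

Lemma mulmx_opnorm N (M : 'M[R]_N) u : enorm (M *m u) <= opnorm M * enorm u.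
Proof.
have [/enorm_eq0 ->|u0] := eqVneq (enorm u) 0; first by rewrite mulmx0 enorm0
  mulr0.
have u1 : 0 < enorm u by rewrite lt_def u0 enorm_ge0.
rewrite -ler_pdivrMr// mulrC.
have -> : (enorm u)^-1 * enorm (M *m u) = enorm (M *m ((enorm u)^-1 *: u)).
  by rewrite -scalemxAr enormZ ger0_norm// invr_ge0 enorm_ge0.
apply: ub_le_sup; last first.
  by exists ((enorm u)^-1 *: u) => //=; rewrite enormZ ger0_norm ?invr_ge0
    ?enorm_ge0// mulVf.
have [K K0 HK] := mulmx_bounded M.
exists K => _ [v /= v1 <-]; apply: le_trans (HK v) _.
by rewrite -[leRHS]mulr1 ler_wpM2l// ltW.
Qed.

Lemma opnorm_ge0 N (M : 'M[R]_N) : 0 <= opnorm M.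
Proof.
have [K K0 HK] := mulmx_bounded M.
apply: ub_le_sup; last by exists 0 => /=; rewrite ?mulmx0 enorm0.
exists K => _ [v /= v1 <-]; apply: le_trans (HK v) _.
by rewrite -[leRHS]mulr1 ler_wpM2l// ltW.
Qed.

Section SupOpnorm.
Context {N : nat}.
Variable M : nat -> 'M[R]_N.
Hypothesis Mb : has_ubound (range (fun k => opnorm (M k))).

Lemma sup_opnorm_ge k : opnorm (M k) <= sup_opnorm M.
Proof. by apply: ub_le_sup => //; exists k. Qed.

Lemma sup_opnorm_ge0 : 0 <= sup_opnorm M.
Proof. exact: le_trans (opnorm_ge0 (M 0%N)) (sup_opnorm_ge 0%N). Qed.

Lemma mulmx_sup_opnorm k u : enorm (M k *m u) <= sup_opnorm M * enorm u.
Proof.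
by apply: le_trans (mulmx_opnorm _ _) _; rewrite ler_wpM2r ?enorm_ge0
  ?sup_opnorm_ge.
Qed.

End SupOpnorm.

Section LambdaMin.
Context {N : nat}.
Variable S : 'M[R]_N.
Hypothesis S_psd : sym_psd S.

Let S0 u : 0 <= wnorm2 S u.
Proof. by have := S_psd.2 u; rewrite /wnorm2 mul0mx dot0l. Qed.

Lemma psd_eigenvalue_ge0 a : eigenvalue S a -> 0 <= a.
Proof.
move=> /eigenvalueP[v vS v0].
pose u : 'cV[R]_N := v^T.
have SvT : S *m u = a *: u.
  by rewrite -[S]trmxK -trmx_mul S_psd.1 vS linearZ.
have u0 : u != 0 by rewrite /u -trmx0 (inj_eq trmx_inj).
by have := S0 u; rewrite /wnorm2 SvT dotZl (pmulr_lge0 _ (dot_gt0 u0)).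
Qed.

Lemma lambda_min_ge0 : 0 <= lambda_min S.
Proof.
rewrite /lambda_min; have [->|/set0P ne] := eqVneq [set a | eigenvalue S a] set0.
  by rewrite inf0.
by apply: lb_le_inf => // a /=; exact: psd_eigenvalue_ge0.
Qed.

(** With w = B^-1 u, nonnegativity of the form at u - t w is a quadratic
inequality in t; at t = 1 / |B^-1| it gives <B u, u> >= |u|^2 / |B^-1|. *)
Lemma psd_unit_coercive (B : 'M[R]_N) : (forall u, 0 <= wnorm2 B u) ->
  B^T = B -> B \in unitmx ->
  exists2 c, 0 < c & forall u, c * dot u u <= wnorm2 B u.
Proof.
move=> B0 Bsym Bu; have [K K0 HK] := mulmx_bounded (invmx B).
exists K^-1 => [|u]; first by rewrite invr_gt0.
pose w := invmx B *m u.
have Bw : B *m w = u by rewrite mulmxA mulmxV// mul1mx.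
have := B0 (u - K^-1 *: w).
rewrite /wnorm2 mulmxBr -scalemxAr Bw !dotE.
have -> : dot (B *m u) w = dot u u by rewrite dot_mulmx Bsym Bw.
have h : dot u w <= K * dot u u.
  apply: le_trans (cauchy_schwarz _ _) _; rewrite -sqr_enorm expr2 mulrCA.
  by rewrite ler_wpM2l ?enorm_ge0 ?HK.
have : K^-1 * (K^-1 * dot u w) <= K^-1 * dot u u.
  rewrite ler_pM2l ?invr_gt0//.
  by rewrite ler_pdivrMl.
lra.
Qed.

(** The infimum nu of the Rayleigh quotient is an eigenvalue: otherwise S - nu
would be invertible and semidefinite, hence coercive by [psd_unit_coercive], and
nu could be increased. So the smallest eigenvalue is at most nu. *)
Lemma lambda_min_le u : lambda_min S * dot u u <= wnorm2 S u.
Proof.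
have [->|u0] := eqVneq u 0; first by rewrite dot0l mulr0 S0.
pose ray := [set wnorm2 S v / dot v v | v in [set v | v != 0]].
pose nu := inf ray.
have ray_lb : has_lbound ray.
  by exists 0 => _ [v /= v0 <-]; rewrite divr_ge0 ?dot_ge0.
have ray_ne : ray !=set0 by exists (wnorm2 S u / dot u u); exists u.
have nu_le v : nu * dot v v <= wnorm2 S v.
  have [->|v0] := eqVneq v 0; first by rewrite dot0l mulr0 S0.
  by rewrite -ler_pdivlMr ?dot_gt0//; apply: ge_inf => //; exists v.
apply: le_trans (nu_le u); rewrite ler_wpM2r ?dot_ge0//.
apply: ge_inf; first by exists 0 => a /=; exact: psd_eigenvalue_ge0.
rewrite /= /eigenvalue /eigenspace kermx_eq0 row_free_unit; apply/negP => Bu.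
have wB v : wnorm2 (S - nu%:M) v = wnorm2 S v - nu * dot v v.
  by rewrite /wnorm2 mulmxBl mul_scalar_mx !dotE.
have [||c c0 Hc] := psd_unit_coercive _ _ Bu.
- by move=> v; rewrite wB subr_ge0.
- by rewrite linearB /= tr_scalar_mx S_psd.1.
have : nu + c <= nu.
  apply: lb_le_inf => // _ [v /= v0 <-].
  by rewrite ler_pdivlMr ?dot_gt0// mulrDl; have := Hc v; rewrite wB; lra.
lra.
Qed.

End LambdaMin.

Lemma gram_psd m n (A : 'M[R]_(m, n)) : sym_psd (A *m A^T).
Proof.
split=> [|u]; first by rewrite trmx_mul trmxK.
by rewrite /wnorm2 mul0mx dot0l -mulmxA dot_mulmx dot_ge0.
Qed.

Lemma gram_lambda_min m n (A : 'M[R]_(m, n)) v :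
  lambda_min (A *m A^T) * dot v v <= dot (A^T *m v) (A^T *m v).
Proof.
apply: le_trans (lambda_min_le (gram_psd A) v) _.
by rewrite /wnorm2 -mulmxA dot_mulmx.
Qed.

End Euclid.

(** * Quadratic remainders and Frechet subgradients *)

Section Smooth.
Context {R : realType} {N : nat}.
Implicit Types (x d u v : 'cV[R]_N).

Lemma diff_gradient (h : 'cV[R]_N -> R) x d : differentiable h x ->
  'd h x d = dot (gradient h x) d :> R.
Proof.
move=> hx; rewrite {1}[d]matrix_sum_delta.
under eq_bigr do rewrite big_ord1.
rewrite linear_sum; apply: eq_bigr => i _.
by rewrite linearZ mxE mulrC.
Qed.

Lemma is_derive_along (h : 'cV[R]_N -> R) x d (t : R) :
  (forall u, differentiable h u) ->
  is_derive t 1 (fun s : R => h (x + s *: d))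
    (dot (gradient h (x + t *: d)) d).
Proof.
move=> hd; set c := x + t *: d.
pose q (s : R) : R := s^-1 *: (h (s *: d + c) - h c).
have hD : cvg (q @ 0^') := @diff_derivable _ _ _ h c d (hd c).
have hE : lim (q @ 0^') = dot (gradient h c) d.
  by rewrite -diff_gradient// -deriveE.
pose phi (s : R) : R := h (x + s *: d).
have E : (fun s : R => s^-1 *: ((phi \o shift t) (s *: (1 : R)) - phi t)) = q.
  apply/funext => s; rewrite /q /phi /=; congr (_ *: (h _ - _)).
  by rewrite [s *: 1]mulr1 scalerDl addrCA.
apply: DeriveDef.
  by rewrite /derivable -/phi E.
by rewrite /derive -/phi E.
Qed.

(** The usual consequence of a Lipschitz gradient. The mean value theorem is
applied on [0, 1] to h (x + t d) - t <grad h x, d> - s (L/2) |d|^2 t^2, which is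
nonincreasing for s = 1 and nondecreasing for s = -1. *)
Lemma quadratic_remainder (h : 'cV[R]_N -> R) (L : R) x d :
  (forall u, differentiable h u) ->
  (forall u v, enorm (gradient h u - gradient h v) <= L * enorm (u - v)) ->
  `|h (x + d) - h x - dot (gradient h x) d| <= L / 2 * dot d d.
Proof.
move=> hd lip; pose D := dot d d.
(* only the values of the directional derivative matter from here on *)
have [gd gdE] : exists gd : 'cV[R]_N -> R, forall u, dot (gradient h u) d = gd u.
  by exists (fun u => dot (gradient h u) d).
pose psi (s t : R) := h (x + t *: d) - (t * gd x + s * (L / 2) * D * t ^+ 2).
have dpsi (s t : R) : is_derive t 1 (psi s)
    (gd (x + t *: d) - (gd x + s * L * D * t)).
  have := is_derive_along x d t hd; rewrite gdE => h1.
  by apply: is_derive_eq; rewrite /GRing.scale /=; field.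
have mvt : forall sg : R, exists2 c : R, c \in `]0, 1[ &
    h (x + d) - h x - gd x - sg * (L / 2 * D)
    = gd (x + c *: d) - gd x - sg * L * D * c.
  move=> sg; have [|c c01] := @MVT R (psi sg) _ 0 1 ltr01 (fun t _ => dpsi sg t).
    apply: derivable_within_continuous => t _.
    exact: (@ex_derive _ _ _ _ _ _ _ (dpsi sg t)).
  rewrite /psi !scale1r scale0r addr0 => E.
  exists c; first exact: c01.
  move: (gd _) (gd x) (h (x + d)) (h x) E => e0 e1 h1 h0.
  rewrite expr0n /= expr1n; lra.
have bd (c : R) : c \in `]0, 1[ -> `|gd (x + c *: d) - gd x| <= L * D * c.
  rewrite in_itv /= => /andP[c0 c1].
  rewrite -!gdE -dotNl -dotDl; apply: le_trans (normr_dot _ _) _.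
  have Ed : x + c *: d - x = c *: d by rewrite addrC addKr.
  have := lip (x + c *: d) x; rewrite Ed enormZ gtr0_norm// => h1.
  rewrite /D -sqr_enorm expr2.
  apply: le_trans (ler_wpM2r (enorm_ge0 d) h1) _.
  by rewrite le_eqVlt; apply/orP; left; apply/eqP; ring.
rewrite gdE -/D ler_norml; apply/andP; split.
  have [c c01] := mvt (-1); have := bd c c01; rewrite ler_norml => /andP[+ _].
  move: (gd _) (gd x) (h (x + d)) (h x) => e0 e1 h1 h0; lra.
have [c c01] := mvt 1; have := bd c c01; rewrite ler_norml => /andP[_].
move: (gd _) (gd x) (h (x + d)) (h x) => e0 e1 h1 h0; lra.
Qed.

(** A quadratic minorant touching f at u is a first order one: the quotient in
the definition is at least - K |v - u|. *)
Lemma frechet_subdiff_quadratic (f : 'cV[R]_N -> \bar R) u d (a K : R) :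
  f u = a%:E -> 0 <= K ->
  (forall v, ((a + dot d (v - u) - K * dot (v - u) (v - u))%:E <= f v)%E) ->
  frechet_subdiff f u d.
Proof.
move=> fu K0 lb; split=> /=; first by rewrite fu ltry.
rewrite limf_einfE; apply/lee_addgt0Pr => e e0.
have N0 : 0 < N%:R + 1 :> R by rewrite ltr_wpDl.
have K1 : 0 < K + 1 by lra.
pose V := [set v : 'cV[R]_N | v != u /\ K * enorm (v - u) <= e].
rewrite -leeBlDr// sub0e; apply: (@le_trans _ _ (ereal_inf
  ((fun v => ((f v - f u - (dot d (v - u))%:E) * ((enorm (v - u))^-1)%:E)%E)
     @` V))); last first.
  apply: ereal_sup_ubound; exists V => //.
  have del0 : 0 < e / ((K + 1) * (N%:R + 1)) by rewrite divr_gt0 ?mulr_gt0.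
  apply/nbhs_ballP; exists (e / ((K + 1) * (N%:R + 1))) => //= v.
  rewrite -ball_normE /= => uv vu; split=> //.
  have h1 := enorm_le_norm (v - u); rewrite distrC in uv.
  move: uv; rewrite ltr_pdivlMr ?mulr_gt0// => uv.
  apply: (@le_trans _ _ ((K + 1) * enorm (v - u))).
    by rewrite ler_wpM2r ?enorm_ge0//; lra.
  apply: le_trans (ler_wpM2l (ltW K1) h1) _.
  by rewrite mulrA mulrC ltW.
apply: le_ereal_inf_tmp => _ [v [vu Kv] <-].
have ev : 0 < enorm (v - u) by rewrite enorm_gt0// subr_eq0.
have := lb v; rewrite fu; case: (f v) => [b| |] //=.
- rewrite lee_fin => h1; rewrite -!EFinB -EFinM lee_fin ler_pdivlMr//.
  rewrite -sqr_enorm in h1.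
  have := ler_wpM2r (enorm_ge0 (v - u)) Kv.
  lra.
- move=> _; rewrite gt0_mulye ?leey// lte_fin invr_gt0//.
Qed.

End Smooth.

(** * Auxiliary inequalities and the stacked product space *)

Section Algebra.
Context {R : realType}.

Lemma dot_mulmxr m n (A : 'M[R]_(m, n)) u v : dot u (A *m v) = dot (A^T *m u) v.
Proof. by rewrite dotC dot_mulmx dotC. Qed.

Lemma sqr_enormD N (u v : 'cV[R]_N) :
  enorm (u + v) ^+ 2 = enorm u ^+ 2 + 2 * dot u v + enorm v ^+ 2.
Proof. by rewrite !sqr_enorm !dotE (dotC v u); ring. Qed.

Lemma wnorm2D N (M : 'M[R]_N) u v : M^T = M ->
  wnorm2 M (u + v) = wnorm2 M u + 2 * dot (M *m u) v + wnorm2 M v.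
Proof.
move=> Msym; rewrite /wnorm2 mulmxDr !dotE.
by rewrite (dot_mulmx M v u) Msym (dotC v); ring.
Qed.

Lemma sqr_enorm_le N1 N2 (u : 'cV[R]_N1) (v : 'cV[R]_N2) (K : R) :
  0 <= K -> enorm u <= K * enorm v -> enorm u ^+ 2 <= K ^+ 2 * enorm v ^+ 2.
Proof.
by move=> K0 ?; rewrite -exprMn ler_pXn2r ?nnegrE ?mulr_ge0 ?enorm_ge0.
Qed.

Lemma wnorm2_le N (M : 'M[R]_N) u (K : R) :
  enorm (M *m u) <= K * enorm u -> wnorm2 M u <= K * enorm u ^+ 2.
Proof.
move=> h; apply: le_trans (cauchy_schwarz _ _) _.
by rewrite expr2 mulrA ler_wpM2r ?enorm_ge0.
Qed.

(** The test direction is a small negative multiple of G. *)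
Lemma first_order_optimality N (G : 'cV[R]_N) (K : R) : 0 <= K ->
  (forall d, 0 <= dot G d + K * enorm d ^+ 2) -> G = 0.
Proof.
move=> K0 h; apply: dot_eq0; apply/eqP; rewrite eq_le dot_ge0 andbT.
have K1 : 0 < K + 1 by lra.
have := h (- ((K + 1)^-1) *: G); rewrite sqr_enorm !dotE => h1.
have h2 := mulr_ge0 (mulr_ge0 (ltW K1) (ltW K1)) h1.
have E : (K + 1) * (K + 1) * (- (K + 1)^-1 * dot G G + K * (- (K + 1)^-1 * (-
  (K + 1)^-1 * dot G G))) = - dot G G.
  by field; rewrite gt_eqF.
by rewrite E oppr_ge0 in h2.
Qed.

(** The plain estimate is 2 (p a + q b)^2 <= 4 p^2 a^2 + 4 q^2 b^2; the point is
the gain kap > 0. For q > 0 it is q^2, the excess on the right. For q = 0, which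
happens for Algorithm 1 without proximal term in x, there is no cross term and
half of 4 p^2 is left over. *)
Lemma weighted_square (p q : R) : 0 <= p -> 0 <= q -> 0 < p + q ->
  exists2 kap : R, 0 < kap & forall a b : R,
    2 * (p * a + q * b) ^+ 2
      <= (4 * p ^+ 2 + q ^+ 2 - kap) * a ^+ 2 + 4 * q ^+ 2 * b ^+ 2.
Proof.
move=> p0 q0 pq; have [q00|qn] := eqVneq q 0.
  subst q; exists (2 * p ^+ 2) => [|a b]; first by rewrite mulr_gt0//
    exprn_gt0; lra.
  by rewrite le_eqVlt; apply/orP; left; apply/eqP; ring.
exists (q ^+ 2) => [|a b]; first by rewrite exprn_gt0// lt_def qn.
have := sqr_ge0 (p * a - q * b); lra.
Qed.

(** For rho <= 1 the vector a' is a convex combination of v and a, and for rho >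
1 one of (rho / (2 - rho)) v and - a with weight 2 - rho. The squared norm is
convex; the terms are arranged so that those in a and a' telescope. *)
Lemma relaxed_dual_step N (rho : R) (v a a' : 'cV[R]_N) :
  0 < rho < 2 -> a' = rho *: v + (1 - rho) *: a ->
  if rho <= 1 then
    rho * dot a' a' <= rho * dot v v + (1 - rho) * (dot a a - dot a' a')
  else (2 - rho) * dot a' a'
    <= rho ^+ 2 / (2 - rho) * dot v v + (rho - 1) * (dot a a - dot a' a').
Proof.
move=> /andP[rho0 rho2] Ea'; case: ifPn => rho1.
  have := dot_convex v a (_ : 0 <= rho <= 1); rewrite rho1 ltW// => /(_ isT).
  rewrite -Ea'; move: (dot _ _) (dot _ _) (dot _ _) => *; lra.
rewrite -ltNge in rho1.
have r2 : 0 < 2 - rho by lra.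
have c01 : 0 <= 2 - rho <= 1 by apply/andP; split; lra.
have := dot_convex ((rho / (2 - rho)) *: v) (- a) c01.
have -> : (2 - rho) *: ((rho / (2 - rho)) *: v) + (1 - (2 - rho)) *: (- a) = a'.
  rewrite Ea' scalerA scalerN -scaleNr; congr (_ *: _ + _ *: _); last by ring.
  by field; rewrite gt_eqF.
set d := dot a' a'; rewrite !dotE opprK.
have -> : (2 - rho) * (rho / (2 - rho) * (rho / (2 - rho) * dot v v))
   = rho ^+ 2 / (2 - rho) * dot v v by field; rewrite gt_eqF.
rewrite /d; move: (_ / _ * dot v v) (dot a a) (dot a' a') => *; lra.
Qed.

Section Stack.
Context {m n : nat}.
Implicit Types (x : 'cV[R]_n) (z : 'cV[R]_m).

Lemma on_stack5E (S : Type) (F : 'cV[R]_n -> 'cV[R]_m -> 'cV[R]_m -> 'cV[R]_n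
  -> 'cV[R]_m -> S)
  x1 z2 z3 x4 z5 : on_stack5 F (stack5 x1 z2 z3 x4 z5) = F x1 z2 z3 x4 z5.
Proof. by rewrite /on_stack5 /stack5 !(col_mxKu, col_mxKd). Qed.

Lemma stack5_split (v : 'cV[R]_(n + (m + (m + (n + m))))) :
  exists x1 z2 z3 x4 z5, v = stack5 x1 z2 z3 x4 z5.
Proof.
exists (usubmx v), (usubmx (dsubmx v)), (usubmx (dsubmx (dsubmx v))),
  (usubmx (dsubmx (dsubmx (dsubmx v)))), (dsubmx (dsubmx (dsubmx (dsubmx v)))).
by rewrite /stack5 !vsubmxK.
Qed.

Lemma stack5B x1 z2 z3 x4 z5 x1' z2' z3' x4' z5' :
  stack5 x1 z2 z3 x4 z5 - stack5 x1' z2' z3' x4' z5'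
  = stack5 (x1 - x1') (z2 - z2') (z3 - z3') (x4 - x4') (z5 - z5').
Proof. by rewrite /stack5 !opp_col_mx !add_col_mx. Qed.

Lemma dot_stack5 x1 z2 z3 x4 z5 x1' z2' z3' x4' z5' :
  dot (stack5 x1 z2 z3 x4 z5) (stack5 x1' z2' z3' x4' z5')
  = dot x1 x1' + (dot z2 z2' + (dot z3 z3' + (dot x4 x4' + dot z5 z5'))).
Proof. by rewrite /stack5 !dot_col_mx. Qed.

Lemma enorm_stack5 x1 z2 z3 x4 z5 :
  enorm (stack5 x1 z2 z3 x4 z5)
  <= enorm x1 + (enorm z2 + (enorm z3 + (enorm x4 + enorm z5))).
Proof.
have H N1 N2 (u : 'cV[R]_N1) (v : 'cV[R]_N2) : enorm (col_mx u v) <= enorm u +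
  enorm v.
  apply: enorm_le; first by rewrite addr_ge0 ?enorm_ge0.
  rewrite dot_col_mx -!sqr_enorm.
  have := mulr_ge0 (enorm_ge0 u) (enorm_ge0 v); lra.
by do 3 (apply: le_trans (H _ _ _ _) _; rewrite lerD2l); exact: H.
Qed.

End Stack.
End Algebra.

(** * The iterates of the algorithms *)

(** Locked, so that rewriting with bilinearity does not look inside. *)
HB.lock Definition increment (V : zmodType) (u : nat -> V) (k : nat) : V :=
  u k.+1 - u k.

HB.lock Definition residual (R : realType) (m n : nat) (A : 'M[R]_(m, n))
  (x : nat -> 'cV[R]_n) (z : nat -> 'cV[R]_m) (k : nat) : 'cV[R]_m :=
  A *m x k.+1 - z k.+1.

Lemma increment_def (V : zmodType) (u : nat -> V) k :
  u k.+1 - u k = increment u k.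
Proof. by rewrite increment.unlock. Qed.

Lemma incrementE (V : zmodType) (u : nat -> V) k : u k.+1 = u k + increment u k.
Proof. by rewrite -increment_def addrC subrK. Qed.

Section ADMM.
Context {R : realType} {m n : nat}.
Variables (alg : algorithm) (g : 'cV[R]_m -> \bar R) (h : 'cV[R]_n -> R).
Variables (L : R) (A : 'M[R]_(m, n)).
Variables (M1 : nat -> 'M[R]_n) (M2 : nat -> 'M[R]_m) (r rho : R).
Variables (x : nat -> 'cV[R]_n) (z y : nat -> 'cV[R]_m).
Hypotheses (g_proper : proper_fun g) (h_diff : forall u, differentiable h u).
Hypothesis h_lip : forall u v,
  enorm (gradient h u - gradient h v) <= L * enorm (u - v).
Hypothesis M2_psd : forall k, sym_psd (M2 k).
Hypothesis M1_psd : forall k, sym_psd (M1 k).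
Hypotheses (r_gt0 : 0 < r) (rho_bd : 0 < rho < 2).
Hypothesis HA' : assumptionA' alg g h L A M1 M2 r rho.
Hypothesis Hgen : generated_by alg g h A M1 M2 r rho x z y.

Let mu := sup_opnorm M1.
Let lam := lambda_min (A *m A^T).
Let T := T0 A rho.

Local Notation dx := (increment x).
Local Notation dy := (increment y).
Local Notation dz := (increment z).
Local Notation gap := (residual A x z).

Lemma gap_def k : A *m x k.+1 - z k.+1 = gap k.
Proof. by rewrite residual.unlock. Qed.

(** The real value of g at an iterate; meaningful from index 1 on, since z 0 is
arbitrary. *)
Definition g_value k : R := fine (g (z k)).

(** The gradient of h as it enters the optimality condition of the x-update: at
the new point for Algorithm 1, at the old one for the linearized Algorithm 2. *)
Definition xstep_gradient k : 'cV[R]_n :=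
  if alg is Algorithm1 then gradient h (x k.+1) else gradient h (x k).

(** The vector towards which A^T y relaxes, see [dual_recursion]. *)
Definition dual_target k : 'cV[R]_n := - xstep_gradient k - M1 k *m dx k.

(** The Lipschitz bounds of the dual target in the new and in the previous step
of x. In terms of these two coefficients the constants of both algorithms have
the same expression ([C1E], [CM'E]), so the estimates need not distinguish them.
*)
Definition coef_new : R := if alg is Algorithm1 then L + mu else mu.
Definition coef_old : R := if alg is Algorithm1 then mu else L + mu.

Let M1_bd := A'_M1_bounded HA'.

(** If lambda_min were 0, then so would T0, whereas 4 T0 L is positive. *)
Lemma lambda_min_gt0 : 0 < lam.
Proof.
have l0 : 0 <= lam := lambda_min_ge0 (gram_psd A).
rewrite lt_def l0 andbT; apply/negP => /eqP E.
have := A'_T0L_gt0 HA'.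
by rewrite /T0 -/lam E; case: ifP => _; rewrite !(mul0r, invr0, mulr0) ltxx.
Qed.

Lemma T0_gt0 : 0 < T.
Proof.
have /andP[? ?] := rho_bd; have l0 := lambda_min_gt0.
rewrite /T /T0 -/lam; case: ifP => _; first by rewrite divr_gt0// mulr_gt0.
by rewrite divr_gt0// mulr_gt0// exprn_gt0// subr_gt0.
Qed.

Lemma L_gt0 : 0 < L.
Proof.
have := A'_T0L_gt0 HA'; rewrite pmulr_rgt0// mulr_gt0//.
exact: T0_gt0.
Qed.

Lemma T1_ge0 : 0 <= T1 A r rho.
Proof.
have /andP[r0 r2] := rho_bd; have l0 := lambda_min_gt0.
rewrite /T1 -/lam; case: ifP => r1.
  by rewrite divr_ge0 ?subr_ge0// ltW// !mulr_gt0// exprn_gt0.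
have {}r1 : 1 <= rho by rewrite ltW// ltNge r1.
by rewrite divr_ge0 ?subr_ge0// ltW// !mulr_gt0// subr_gt0.
Qed.

Lemma mu_ge0 : 0 <= mu. Proof. exact: sup_opnorm_ge0. Qed.

Lemma C1E : C1 alg A r rho L mu = 4 * T * coef_old ^+ 2 / r.
Proof. by rewrite /C1 /coef_old; case: alg. Qed.

Lemma CM'E : CM' alg A rho L mu = (8 * coef_new ^+ 2 + 10 * coef_old ^+ 2) * T.
Proof. by rewrite /CM' /coef_old /coef_new -/T; case: alg => //; ring. Qed.

Lemma coef_new_ge0 : 0 <= coef_new.
Proof.
have := L_gt0; have := mu_ge0; rewrite /coef_new; case: alg => //; lra.
Qed.

Lemma coef_old_ge0 : 0 <= coef_old.
Proof.
have := L_gt0; have := mu_ge0; rewrite /coef_old; case: alg => //; lra.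
Qed.

Lemma coef_sum_gt0 : 0 < coef_new + coef_old.
Proof.
have := L_gt0; have := mu_ge0; rewrite /coef_old /coef_new; case: alg; lra.
Qed.

Lemma C1_ge0 : 0 <= C1 alg A r rho L mu.
Proof.
by rewrite C1E divr_ge0 ?(ltW r_gt0)// mulr_ge0 ?sqr_ge0// ltW// mulr_gt0
  ?T0_gt0. Qed.

Lemma dy_gap k : dy k = (rho * r) *: gap k.
Proof.
by have [_ _ E] := Hgen k; move: E; rewrite incrementE gap_def => /addrI. Qed.

Lemma rhor_gt0 : 0 < rho * r.
Proof. by rewrite mulr_gt0//; case/andP: rho_bd. Qed.

Lemma gap_dy k : gap k = (rho * r)^-1 *: dy k.
Proof. by rewrite dy_gap scalerA mulVf ?scale1r// gt_eqF// rhor_gt0. Qed.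

(** A minimizer of the z-objective cannot have value +oo because g is proper. *)
Lemma g_finite k : g (z k.+1) = (g_value k.+1)%:E.
Proof.
have [gNy [u0 gu0]] := g_proper; have [/(_ u0) hz _ _] := Hgen k.
rewrite /g_value fineK// fin_numE gNy /=; apply: contra_neq gu0 => E.
move: hz; rewrite /z_objective E addye// leye_eq; have := gNy u0.
by case: (g u0).
Qed.

(** Minimality in z, read as a minorant of g. *)
Lemma z_optimality k v :
  ((g_value k.+1 + (dot (y k) (A *m x k - z k.+1)
          + r / 2 * enorm (A *m x k - z k.+1) ^+ 2
          + 1 / 2 * wnorm2 (M2 k) (z k.+1 - z k)))%:E
   - (dot (y k) (A *m x k - v) + r / 2 * enorm (A *m x k - v) ^+ 2
          + 1 / 2 * wnorm2 (M2 k) (v - z k))%:E <= g v)%E.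
Proof.
have [/(_ v) hz _ _] := Hgen k; move: hz; rewrite /z_objective g_finite -EFinD.
by rewrite leeBlDr.
Qed.

(** The part of the x-objective that differs between the two algorithms. *)
Definition x_model k v : R :=
  if alg is Algorithm1 then h v else dot (v - x k) (gradient h (x k)).

Lemma x_objectiveE k v :
  x_objective alg h A r (M1 k) (x k) (z k.+1) (y k) v =
  x_model k v + dot (y k) (A *m v - z k.+1) + r / 2 * enorm (A *m v - z k.+1) ^+ 2
  + 1 / 2 * wnorm2 (M1 k) (v - x k).
Proof. by rewrite /x_objective /x_model; case: alg. Qed.

Lemma x_model_le k d : x_model k (x k.+1 + d)
  <= x_model k (x k.+1) + dot (xstep_gradient k) d + L / 2 * enorm d ^+ 2.
Proof.
rewrite /x_model /xstep_gradient sqr_enorm; case: alg.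
  have := quadratic_remainder (x k.+1) d h_diff h_lip.
  by rewrite ler_norml => /andP[_]; rewrite !lerBlDl addrA.
rewrite (_ : x k.+1 + d - x k = (x k.+1 - x k) + d); last by rewrite addrAC.
rewrite dotDl (dotC d) lerDl mulr_ge0 ?dot_ge0// divr_ge0//.
exact: ltW L_gt0.
Qed.

(** First order condition of the x-update, obtained by expanding the objective
around its minimizer up to a quadratic error. *)
Lemma x_optimality k : A^T *m y k + r *: (A^T *m gap k) = dual_target k.
Proof.
have [_ hx _] := Hgen k.
have [KA KA0 HA] := mulmx_bounded A.
apply/subr0_eq; apply: (@first_order_optimality _ _ _
    (L / 2 + r / 2 * KA ^+ 2 + mu / 2)).
  have := mulr_ge0 (ltW r_gt0) (sqr_ge0 KA); have := mu_ge0; have := L_gt0; lra.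
move=> d; have := hx (x k.+1 + d); rewrite !x_objectiveE.
have -> : A *m (x k.+1 + d) - z k.+1 = gap k + A *m d by rewrite mulmxDr addrAC
  gap_def.
have -> : x k.+1 + d - x k = dx k + d by rewrite addrAC increment_def.
rewrite gap_def increment_def (sqr_enormD (gap k)) (wnorm2D _ _ (M1_psd k).1).
rewrite (dotDr (gap k)).
have := x_model_le k d.
have := sqr_enorm_le (ltW KA0) (HA d).
have := wnorm2_le (mulmx_sup_opnorm M1_bd k d); rewrite -/mu.
have -> : dot (A^T *m y k + r *: (A^T *m gap k) - dual_target k) d
    = dot (y k) (A *m d) + r * dot (gap k) (A *m d)
      + dot (xstep_gradient k) d + dot (M1 k *m dx k) d.
  by rewrite /dual_target opprB opprK !dotDl dotZl !(dot_mulmxr A) -!addrA [_ +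
    dot (M1 k *m _) d]addrC.
move: (x_model k (x k.+1 + d)) (x_model k (x k.+1)) (wnorm2 _ d) (wnorm2 _ (dx
  k)).
move: (dot (xstep_gradient k) d) (dot (M1 k *m dx k) d) (dot (gap k) (A *m d)).
move: (dot (y k) (gap k)) (dot (y k) (A *m d)) (enorm d ^+ 2) (enorm (gap k) ^+
  2).
move: (enorm (A *m d) ^+ 2).
move=> a0 a1 a2 a3 a4 a5 a6 a7 a8 a9 a10 a11 h1 h2 h3 h4.
have := ler_wpM2l (ltW r_gt0) h2.
lra.
Qed.

(** The y-update rewrites [x_optimality] as A^T y_{k+1} = rho w_k + (1 - rho)
A^T y_k with w the dual target; take differences. *)
Lemma dual_recursion k :
  A^T *m dy k.+1 = rho *: (dual_target k.+1 - dual_target k)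
                   + (1 - rho) *: (A^T *m dy k).
Proof.
have Ay j : A^T *m y j.+1 = rho *: dual_target j + (1 - rho) *: (A^T *m y j).
  rewrite incrementE mulmxDr dy_gap -scalemxAr -x_optimality.
  move: (A^T *m y j) (A^T *m residual A x z j) => a b.
  by apply/matrixP => i l; rewrite !mxE; ring.
rewrite -(increment_def y) -(increment_def y k) !mulmxBr (Ay k.+1) (Ay k).
move: (A^T *m y k) (dual_target k) (dual_target k.+1) => a b c.
by apply/matrixP => i l; rewrite !mxE; ring.
Qed.

Lemma dual_target_step k :
  enorm (dual_target k.+1 - dual_target k)
    <= coef_new * enorm (dx k.+1) + coef_old * enorm (dx k).
Proof.
have gs j : enorm (gradient h (x j.+1) - gradient h (x j)) <= L * enorm (dx j).
  by apply: le_trans (h_lip _ _) _; rewrite increment_def.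
have Ms j := mulmx_sup_opnorm M1_bd j (dx j).
have -> : dual_target k.+1 - dual_target k
   = - (xstep_gradient k.+1 - xstep_gradient k)
     + (- (M1 k.+1 *m dx k.+1) + M1 k *m dx k).
  rewrite /dual_target; move: (M1 k *m _) (M1 k.+1 *m _) (xstep_gradient k) =>
    a b c.
  by move: (xstep_gradient _) => d; apply/matrixP => i j; rewrite !mxE; ring.
apply: le_trans (enormD _ _) _; rewrite enormN.
have hM := enormD (- (M1 k.+1 *m dx k.+1)) (M1 k *m dx k); rewrite enormN in hM.
apply: le_trans (lerD (lexx _) (le_trans hM (lerD (Ms k.+1) (Ms k)))) _.
rewrite -/mu /coef_new /coef_old /xstep_gradient.
case: alg => /=; [move: (gs k.+1)|move: (gs k)];
  move: (enorm (_ - _)) (enorm (dx k)) (enorm (dx k.+1)) => a b c; lra.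
Qed.

(** The increase of the augmented Lagrangian in the y-update is half of the
left-hand side; the other half is kept as decrease in y. Multiplying
[relaxed_dual_step] by 2 / (rho r lambda_min) and dividing by rho, respectively
by 2 - rho, produces exactly the constants T0 and T1. *)
Lemma dual_step k :
  2 / (rho * r) * enorm (dy k.+1) ^+ 2
    <= 2 * T / r * enorm (dual_target k.+1 - dual_target k) ^+ 2
       + 2 * T1 A r rho
         * (enorm (A^T *m dy k) ^+ 2 - enorm (A^T *m dy k.+1) ^+ 2).
Proof.
have l0 := lambda_min_gt0; have r0 := r_gt0; have rr := rhor_gt0.
have /andP[rho0 rho2] := rho_bd.
have := gram_lambda_min A (dy k.+1); rewrite -/lam -!sqr_enorm.
have := relaxed_dual_step rho_bd (dual_recursion k).
rewrite -!sqr_enorm /T /T0 /T1 -/lam.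
move: (enorm (dy k.+1) ^+ 2) (enorm (A^T *m dy k) ^+ 2) => b c.
move: (enorm (A^T *m dy k.+1) ^+ 2) (enorm (_ - _) ^+ 2) => a v.
move=> + lb.
have bl : 2 / (rho * r) * b <= 2 / (rho * r * lam) * a.
  have -> : 2 / (rho * r * lam) * a = 2 / (rho * r) * (a / lam).
    by field; rewrite !gt_eqF.
  by rewrite ler_wpM2l ?divr_ge0 ?(ltW rr)// ler_pdivlMr// mulrC.
case: ifPn => rho1 h1.
  have : 0 <= 2 / (rho ^+ 2 * r * lam) by rewrite divr_ge0 ?mulr_ge0 ?sqr_ge0
    ?ltW.
  move=> /ler_wpM2l /(_ _ _ h1).
  have -> : 2 / (rho ^+ 2 * r * lam) * (rho * a) = 2 / (rho * r * lam) * a.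
    by field; rewrite !gt_eqF.
  have -> : 2 / (rho ^+ 2 * r * lam) * (rho * v + (1 - rho) * (c - a))
    = 2 * (1 / (lam * rho)) / r * v + 2 * ((1 - rho) / (lam * rho ^+ 2 * r)) *
      (c - a).
    by field; rewrite !gt_eqF.
  exact: le_trans.
have r2 : 0 < 2 - rho by rewrite subr_gt0.
have : 0 <= 2 / (rho * r * lam * (2 - rho)).
  by rewrite divr_ge0// ltW// !mulr_gt0.
move=> /ler_wpM2l /(_ _ _ h1).
have -> : 2 / (rho * r * lam * (2 - rho)) * ((2 - rho) * a) = 2 / (rho * r *
  lam) * a.
  by field; rewrite !gt_eqF.
have -> : 2 / (rho * r * lam * (2 - rho)) * (rho ^+ 2 / (2 - rho) * v + (rho -
  1) * (c - a))
    = 2 * (rho / (lam * (2 - rho) ^+ 2)) / r * v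
      + 2 * ((rho - 1) / (lam * (2 - rho) * rho * r)) * (c - a).
  by field; rewrite !gt_eqF.
exact: le_trans.
Qed.

(** The available coefficient CM' / (2 r) exceeds the need by c2 > 0, thanks to
[weighted_square]. The term in the previous step of x is paid by the summand
with C1 in the regularized Lagrangian. *)
Lemma sqr_dual_target_step : exists2 c2, 0 < c2 & forall k,
  2 * T / r * enorm (dual_target k.+1 - dual_target k) ^+ 2
  <= (CM' alg A rho L mu / (2 * r) - C1 alg A r rho L mu - c2)
       * enorm (dx k.+1) ^+ 2
     + C1 alg A r rho L mu * enorm (dx k) ^+ 2.
Proof.
have Tr : 0 < T / r by rewrite divr_gt0 ?T0_gt0.
have r0 := r_gt0.
have [kap kap0 hk] := weighted_square coef_new_ge0 coef_old_ge0 coef_sum_gt0.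
exists (T / r * kap) => [|k]; first by rewrite mulr_gt0.
have h1 : enorm (dual_target k.+1 - dual_target k) ^+ 2
    <= (coef_new * enorm (dx k.+1) + coef_old * enorm (dx k)) ^+ 2.
  rewrite ler_pXn2r ?nnegrE ?enorm_ge0 ?dual_target_step//.
  by rewrite addr_ge0 ?mulr_ge0 ?enorm_ge0 ?coef_new_ge0 ?coef_old_ge0.
have h2 := ler_wpM2l (ltW Tr) (hk (enorm (dx k.+1)) (enorm (dx k))).
have := ler_wpM2l (ltW Tr) h1.
rewrite CM'E C1E.
move: (enorm (_ - _)) (enorm (dx k.+1)) (enorm (dx k)) h2 => e a b.
move: coef_new coef_old => p q h2 h3.
have -> : ((8 * p ^+ 2 + 10 * q ^+ 2) * T / (2 * r) - 4 * T * q ^+ 2 / r - T /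
  r * kap) * a ^+ 2
    + 4 * T * q ^+ 2 / r * b ^+ 2
    = T / r * ((4 * p ^+ 2 + q ^+ 2 - kap) * a ^+ 2 + 4 * q ^+ 2 * b ^+ 2).
  by field; rewrite gt_eqF.
apply: le_trans h2.
have -> : 2 * T / r * e ^+ 2 = 2 * (T / r * e ^+ 2) by ring.
have -> : T / r * (2 * (p * a + q * b) ^+ 2) = 2 * (T / r * (p * a + q * b) ^+ 2).
  by ring.
by rewrite ler_pM2l.
Qed.

Definition augL_value gv (u : 'cV[R]_n) (v w : 'cV[R]_m) : R :=
  gv + (h u + dot w (A *m u - v) + r / 2 * enorm (A *m u - v) ^+ 2).

Lemma augL_z_decrease k :
  augL_value (g_value k.+2) (x k.+1) (z k.+2) (y k.+1)
  <= augL_value (g_value k.+1) (x k.+1) (z k.+1) (y k.+1).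
Proof.
have := z_optimality k.+1 (z k.+1); rewrite g_finite -EFinD lee_fin subrr.
have -> : wnorm2 (M2 k.+1) 0 = 0 by rewrite /wnorm2 mulmx0 dot0l.
have := (M2_psd k.+1).2 (z k.+2 - z k.+1).
rewrite {1}/wnorm2 mul0mx dot0l /augL_value.
move: (wnorm2 _ _) (h _) (dot _ (_ - z k.+2)) (enorm (_ - z k.+2)) => a b c d.
move: (dot _ _) (enorm _) (g_value k.+2) (g_value k.+1) => *; lra.
Qed.

Lemma model_decrease k :
  h (x k.+1)
  <= h (x k) + dot (xstep_gradient k) (dx k) + L / 2 * enorm (dx k) ^+ 2.
Proof.
rewrite /xstep_gradient sqr_enorm; case: alg; last first.
  have := quadratic_remainder (x k) (dx k) h_diff h_lip.
  by rewrite -incrementE ler_norml => /andP[_]; rewrite !lerBlDl addrA.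
have := quadratic_remainder (x k.+1) (- dx k) h_diff h_lip.
have -> : x k.+1 - dx k = x k by rewrite incrementE addrK.
rewrite ler_norml => /andP[+ _]; rewrite !dotE opprK.
move: (h _) (h _) (dot _ _) (dot _ _) => *; lra.
Qed.

(** The terms depending on A x are exactly quadratic, so their decrease contains
the full r/2 |A dx|^2; together with the proximal term it outweighs the loss L/2
|dx|^2 from the nonconvex h by the matrix inequality of the assumption. *)
Lemma augL_x_decrease k gv :
  augL_value gv (x k.+1) (z k.+1) (y k)
    + CM' alg A rho L mu / (2 * r) * enorm (dx k) ^+ 2
  <= augL_value gv (x k) (z k.+1) (y k).
Proof.
rewrite /augL_value gap_def.
have -> : A *m x k - z k.+1 = gap k - A *m dx k.
  rewrite -gap_def -(increment_def x) mulmxBr; apply/matrixP => i j;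
    rewrite !mxE; ring.
have lw := A'_loewner HA' k (dx k).
have E1 : wnorm2 (L + CM' alg A rho L mu / r)%:M (dx k)
    = (L + CM' alg A rho L mu / r) * enorm (dx k) ^+ 2.
  by rewrite /wnorm2 mul_scalar_mx dotZl sqr_enorm.
have E2 : wnorm2 (2 *: M1 k + r *: (A^T *m A)) (dx k)
    = 2 * dot (M1 k *m dx k) (dx k) + r * enorm (A *m dx k) ^+ 2.
  rewrite /wnorm2 mulmxDl -!scalemxAl !dotE -mulmxA sqr_enorm.
  by rewrite (dot_mulmx A^T) trmxK.
rewrite E1 E2 in lw.
rewrite (sqr_enormD (gap k)) enormN !dotDr !dotNr.
have xs : dot (y k) (A *m dx k) + r * dot (gap k) (A *m dx k)
    = - dot (xstep_gradient k) (dx k) - dot (M1 k *m dx k) (dx k).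
  by rewrite !dot_mulmxr -dotZl -dotDl x_optimality /dual_target dotDl !dotNl.
have md := model_decrease k.
have -> : CM' alg A rho L mu / (2 * r) = CM' alg A rho L mu / r / 2.
  by field; rewrite gt_eqF.
move: (CM' _ _ _ _ _ / r) lw => c lw.
move: (dot (y k) (gap k)) (dot (y k) (A *m dx k)) xs => a1 a2 xs.
move: (dot (gap k) (A *m dx k)) (dot (xstep_gradient k) (dx k)) xs md => a3 a4
  xs md.
move: (dot (M1 k *m dx k) (dx k)) (enorm (A *m dx k) ^+ 2) lw xs => a5 a6 lw xs.
move: (h (x k.+1)) (h (x k)) (enorm (dx k) ^+ 2) (enorm (gap k) ^+ 2) lw xs md
  => a7 a8 a9 a10 lw xs md.
lra.
Qed.

Lemma augL_y_increase k gv :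
  augL_value gv (x k.+1) (z k.+1) (y k.+1)
  = augL_value gv (x k.+1) (z k.+1) (y k) + 1 / (rho * r) * enorm (dy k) ^+ 2.
Proof.
rewrite /augL_value !gap_def (incrementE y) dotDl {2}gap_dy dotZr -sqr_enorm.
by rewrite mul1r; ring.
Qed.

(** The (finite) value of the regularized augmented Lagrangian at the (k+1)-st
iterate. *)
Definition regL_value k : R :=
  augL_value (g_value k.+1) (x k.+1) (z k.+1) (y k.+1)
  + (2 * T1 A r rho * enorm (A^T *m dy k) ^+ 2
     + C1 alg A r rho L mu * enorm (dx k) ^+ 2).

(** The three updates combined: half of the estimate in [dual_step] pays for the
increase in the y-update, and the other half remains as decrease in y. *)
Lemma sufficient_decrease : exists2 c : R, 0 < c & forall k,
  c * (enorm (dx k.+1) ^+ 2 + enorm (dy k.+1) ^+ 2)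
  <= regL_value k - regL_value k.+1.
Proof.
have [c2 c20 hv] := sqr_dual_target_step.
have rr := rhor_gt0.
have c30 : 0 < 1 / (rho * r) by rewrite divr_gt0.
exists (Num.min c2 (1 / (rho * r))) => [|k]; first by rewrite lt_min c20.
have hz := augL_z_decrease k; have hx := augL_x_decrease k.+1 (g_value k.+2).
have hy := augL_y_increase k.+1 (g_value k.+2); have hd := dual_step k;
  have {}hv := hv k.
have hm : forall a b, 0 <= a -> 0 <= b ->
    Num.min c2 (1 / (rho * r)) * (a + b) <= c2 * a + 1 / (rho * r) * b.
  move=> a b a0 b0; rewrite mulrDr.
  by rewrite lerD// ler_wpM2r// ge_min lexx ?orbT.
have {}hm := hm _ _ (sqr_ge0 (enorm (dx k.+1))) (sqr_ge0 (enorm (dy k.+1))).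
apply: le_trans hm _.
have E : 2 / (rho * r) = 2 * (1 / (rho * r)) by rewrite mul1r.
rewrite {}E in hd; rewrite /regL_value; rewrite mulrBl mulrBl in hv.
move: (augL_value (g_value k.+2) (x k.+1) (z k.+2) (y k.+1)) hx hz => l1 hx hz.
move: (augL_value _ _ _ _) hx hy => l2 hx hy.
move: (augL_value _ _ _ _) hy hz => l3 hy hz.
move: (augL_value _ _ _ _) hz => l4 hz.
move: (1 / (rho * r)) hy hd => c3 hy hd.
move: (2 * T / r * _) (CM' _ _ _ _ _ / _) hx hd hv => c4 c5 hx hd hv.
move: (C1 _ _ _ _ _ _) hv => c6 hv.
move: (enorm _ ^+ 2) (enorm _ ^+ 2) hx hv => a1 a2 hx hv.
move: (enorm _ ^+ 2) hy hd => a3 hy hd.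
move: (T1 _ _ _) (enorm _ ^+ 2) (enorm _ ^+ 2) hd => t1 a4 a5 hd.
lra.
Qed.

(** * A small subgradient at each iterate *)

Local Notation F := (regL alg g h L A mu r rho).
Local Notation C1r := (C1 alg A r rho L mu).
Local Notation T1r := (T1 A r rho).

(** The point of the product space at which the k-th value is taken; its last
two components are the previous x and y. *)
Definition iterate k := stack5 (x k.+1) (z k.+1) (y k.+1) (x k) (y k).

Lemma F_iterate k : F (x k.+1) (z k.+1) (y k.+1) (x k) (y k) = (regL_value k)%:E.
Proof.
by rewrite /regL /augL g_finite -!EFinD /regL_value /augL_value !(increment_def
  x) !(increment_def y).
Qed.

Definition subgrad_x k := gradient h (x k.+1) + A^T *m y k.+1
  + r *: (A^T *m gap k) + (2 * C1r) *: dx k.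
(** Minus the gradient, at z_{k+1}, of the quadratic part of the z-objective,
which is a subgradient of g there, plus the gradient in z of the remaining
smooth part. *)
Definition subgrad_z k := y k + r *: (gap k - A *m dx k) - M2 k *m dz k
  - y k.+1 - r *: gap k.
Definition subgrad_y k := gap k + (4 * T1r) *: (A *m (A^T *m dy k)).
Definition subgrad_x' k := - ((2 * C1r) *: dx k).
Definition subgrad_y' k := - ((4 * T1r) *: (A *m (A^T *m dy k))).
Definition subgrad k := stack5 (subgrad_x k) (subgrad_z k) (subgrad_y k)
  (subgrad_x' k) (subgrad_y' k).

(** The optimality of z_{k+1} bounds g from below by a quadratic, and
[quadratic_remainder] does the same for h; all other terms are quadratic. Hence
[frechet_subdiff_quadratic] applies once the linear parts are matched. *)
Lemma frechet_subgrad k : frechet_subdiff (on_stack5 F) (iterate k) (subgrad k).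
Proof.
have [KA KA0 HA] := mulmx_bounded A.
have [KM KM0 HM] := mulmx_bounded (M2 k).
have L0 := L_gt0; have r0 := r_gt0.
pose K := L / 2 + r / 2 + KM / 2 + KA ^+ 2 + 2.
have K0 : 0 <= K by rewrite /K; have := sqr_ge0 KA; lra.
apply: (@frechet_subdiff_quadratic _ _ _ _ _ (regL_value k) K) => // [|v].
  by rewrite /iterate on_stack5E F_iterate.
have [v1 [v2 [v3 [v4 [v5 ->]]]]] := stack5_split v.
rewrite on_stack5E /iterate stack5B /subgrad !dot_stack5 -!sqr_enorm.
set d1 := v1 - _; set d2 := v2 - _; set d3 := v3 - _.
set d4 := v4 - _; set d5 := v5 - _.
have E1 : v1 = x k.+1 + d1 by rewrite addrC subrK.
have E2 : v2 = z k.+1 + d2 by rewrite addrC subrK.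
have E3 : v3 = y k.+1 + d3 by rewrite addrC subrK.
have E4 : v1 - v4 = dx k + (d1 - d4).
  by rewrite -(increment_def x) /d1 /d4; apply/matrixP => i j; rewrite !mxE; ring.
have E5 : v3 - v5 = dy k + (d3 - d5).
  by rewrite -(increment_def y) /d3 /d5; apply/matrixP => i j; rewrite !mxE; ring.
have Ed : A *m v1 - v2 = gap k + (A *m d1 - d2).
  rewrite E1 E2 mulmxDr -gap_def; move: (A *m _) (A *m _) => a b.
  by apply/matrixP => i j; rewrite !mxE; ring.
have Es : A *m x k - z k.+1 = gap k - A *m dx k.
  rewrite -gap_def -(increment_def x) mulmxBr; move: (A *m _) (A *m _) => a b.
  by apply/matrixP => i j; rewrite !mxE; ring.
have Es2 : A *m x k - v2 = (gap k - A *m dx k) + - d2.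
  by rewrite -Es /d2; move: (A *m _) => a; apply/matrixP => i j; rewrite !mxE;
    ring.
have Ez : v2 - z k = dz k + d2.
  by rewrite -(increment_def z) /d2; apply/matrixP => i j; rewrite !mxE; ring.
clearbody d1 d2 d3 d4 d5.
have zs := z_optimality k v2.
rewrite Es2 Ez Es (increment_def z) in zs.
rewrite /regL /augL E4 E5 Ed E1 E3 -addeA -EFinD.
apply: le_trans (leeD zs (lexx _)); rewrite -EFinB -EFinD lee_fin.
clear zs Es Es2 Ez Ed E1 E2 E3 E4 E5.
have := quadratic_remainder (x k.+1) d1 h_diff h_lip.
rewrite ler_norml => /andP[hq _].
have hA := sqr_enorm_le (ltW KA0) (HA d1).
have hM := wnorm2_le (HM d2).
have hB : enorm (A *m d1 - d2) ^+ 2 <= 2 * enorm (A *m d1) ^+ 2 + 2 * enorm d2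
  ^+ 2.
  by rewrite !sqr_enorm; have := dotD_le (A *m d1) (- d2);
    rewrite dotNl dotNr opprK.
have hY := dot_young d3 (A *m d1 - d2); rewrite -!sqr_enorm in hq hY.
rewrite /regL_value /augL_value gap_def mulmxDr.
rewrite (sqr_enormD (gap k) (A *m d1 - d2)) (sqr_enormD (dx k)) (sqr_enormD
  (A^T *m dy k)).
rewrite (sqr_enormD (gap k - A *m dx k)) enormN (wnorm2D _ _ (M2_psd k).1).
have -> : dot (subgrad_x k) d1 = dot (gradient h (x k.+1)) d1
    + dot (y k.+1) (A *m d1) + r * dot (gap k) (A *m d1) + 2 * C1r * dot (dx k)
      d1.
  by rewrite /subgrad_x !dotDl !dotZl !(dot_mulmxr A).
have -> : dot (subgrad_z k) d2 = dot (y k) d2 + r * dot (gap k - A *m dx k) d2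
    - dot (M2 k *m dz k) d2 - dot (y k.+1) d2 - r * dot (gap k) d2.
  rewrite /subgrad_z; move: (gap k - _) => s.
  by rewrite !dotDl !dotNl !dotZl.
have -> : dot (subgrad_y k) d3 = dot d3 (gap k)
    + 4 * T1r * dot (A^T *m dy k) (A^T *m d3).
  by rewrite /subgrad_y dotDl dotZl dot_mulmx (dotC (gap k)).
have -> : dot (subgrad_x' k) d4 = - (2 * C1r * dot (dx k) d4).
  by rewrite /subgrad_x' dotNl dotZl.
have -> : dot (subgrad_y' k) d5 = - (4 * T1r * dot (A^T *m dy k) (A^T *m d5)).
  by rewrite /subgrad_y' dotNl dotZl dot_mulmx.
rewrite mulmxBr (dotDr _ _ (A^T *m dy k)) (dotNr (A^T *m dy k)).
rewrite (dotDr _ _ (dx k)) (dotNr (dx k)).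
rewrite !(dotDr _ _ (y k)) !(dotNr (y k)) dotNr.
rewrite (dotDl (y k.+1) d3) !(dotDr _ _ (y k.+1)) (dotNr (y k.+1)).
rewrite (dotDr _ _ (gap k)) (dotNr (gap k)) (dotDr (gap k) _ d3).
have hK : (L / 2 + KA ^+ 2) * enorm d1 ^+ 2 + (r / 2 + KM / 2 + 1) * enorm d2 ^+ 2
    + 1 / 2 * enorm d3 ^+ 2
    <= K * (enorm d1 ^+ 2 + (enorm d2 ^+ 2 + (enorm d3 ^+ 2 + (enorm d4 ^+ 2 +
      enorm d5 ^+ 2)))).
  have hc c a : 0 <= a -> c <= K -> c * a <= K * a by move=> *; rewrite ler_wpM2r.
  have KA2 := sqr_ge0 KA.
  have h1 := hc (L / 2 + KA ^+ 2) _ (sqr_ge0 (enorm d1)).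
  have h2 := hc (r / 2 + KM / 2 + 1) _ (sqr_ge0 (enorm d2)).
  have h3 := hc (1 / 2) _ (sqr_ge0 (enorm d3)).
  have h4 := mulr_ge0 K0 (sqr_ge0 (enorm d4)).
  have h5 := mulr_ge0 K0 (sqr_ge0 (enorm d5)).
  have {}h1 := h1 ltac:(rewrite /K; lra).
  have {}h2 := h2 ltac:(rewrite /K; lra).
  have {}h3 := h3 ltac:(rewrite /K; lra).
  rewrite !mulrDr; lra.
have nT := mulr_ge0 T1_ge0 (sqr_ge0 (enorm (A^T *m d3 - A^T *m d5))).
have nC := mulr_ge0 C1_ge0 (sqr_ge0 (enorm (d1 - d4))).
have nr := mulr_ge0 (ltW r_gt0) (sqr_ge0 (enorm (A *m d1 - d2))).
move: (K * _) hK => b0 hK {K0}.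
move: (enorm (A *m d1 - d2) ^+ 2) hB hY nr => b1 hB hY nr.
move: (enorm (A^T *m d3 - A^T *m d5) ^+ 2) nT => b2 nT.
move: (enorm (d1 - d4) ^+ 2) nC => b3 nC.
move: (enorm (A *m d1) ^+ 2) hA hB => b4 hA hB.
move: (enorm d1 ^+ 2) hq hA hK => b5 hq hA hK.
move: (enorm d2 ^+ 2) hM hB hK => b6 hM hB hK.
move: (enorm d3 ^+ 2) hY hK => b7 hY hK.
move: (dot d3 (A *m d1 - d2)) hY => b8 hY.
move: (h (x k.+1 + d1)) (h (x k.+1)) (dot (gradient h (x k.+1)) d1) hq => b9
  b10 b11 hq.
move: (wnorm2 (M2 k) d2) (wnorm2 (M2 k) (dz k)) hM => b12 b13 hM.
move: (enorm (gap k - A *m dx k) ^+ 2) (dot (gap k - A *m dx k) d2) => b14 b15.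
move: (enorm (gap k) ^+ 2) (enorm (dx k) ^+ 2) (enorm (A^T *m dy k) ^+ 2) =>
  b16 b17 b18.
move: (dot (y k) (gap k)) (dot (y k) (A *m dx k)) (dot (y k) d2) => b19 b20 b21.
move: (dot (y k.+1) (gap k)) (dot (y k.+1) (A *m d1)) (dot (y k.+1) d2) => b22
  b23 b24.
move: (dot (gap k) (A *m d1)) (dot (gap k) d2) (dot d3 (gap k)) => b25 b26 b27.
move: (dot (dx k) d1) (dot (dx k) d4) (dot (M2 k *m dz k) d2) => b28 b29 b30.
move: (dot (A^T *m dy k) (A^T *m d3)) (dot (A^T *m dy k) (A^T *m d5)) => b31 b32.
move: C1r T1r (g_value k.+1) nC nT => b33 b34 b35 nC nT.
clear - hB hY nr nT nC hA hq hM hK.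

lra.
Qed.

Definition steplen k : R := enorm (dx k) + enorm (dy k).

Lemma steplen_ge0 k : 0 <= steplen k.
Proof. by rewrite addr_ge0 ?enorm_ge0. Qed.

Lemma enorm_dx_le k : enorm (dx k) <= steplen k.
Proof. by rewrite lerDl enorm_ge0. Qed.

Lemma enorm_dy_le k : enorm (dy k) <= steplen k.
Proof. by rewrite lerDr enorm_ge0. Qed.

Lemma enorm_gap k : enorm (gap k) = (rho * r)^-1 * enorm (dy k).
Proof. by rewrite gap_dy enormZ ger0_norm// invr_ge0 ltW// rhor_gt0. Qed.

(** The z-steps need not decrease by a fixed multiple of their square, as M2 may
vanish; they are expressed through the other steps instead. *)
Lemma dz_recursion k : dz k.+1 = A *m dx k.+1 - (gap k.+1 - gap k).
Proof.
rewrite -(increment_def x) -(increment_def z) -!gap_def mulmxBr.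
move: (A *m x k.+2) (A *m x k.+1) => a b.
by apply/matrixP => i j; rewrite !mxE; ring.
Qed.

(** The optimality condition of the x-update cancels everything that is not
proportional to a step. *)
Lemma subgrad_xE k : subgrad_x k = (gradient h (x k.+1) - xstep_gradient k)
  + (A^T *m dy k + (- (M1 k *m dx k) + (2 * C1r) *: dx k)).
Proof.
rewrite /subgrad_x (incrementE y) mulmxDr.
have := x_optimality k; rewrite /dual_target.
move: (A^T *m y k) (r *: _) (A^T *m dy k) (M1 k *m dx k) => a b c d.
move: (gradient _ _) (xstep_gradient k) (_ *: dx k) => e f s /(canRL (addrK b))
  ->.
by apply/matrixP => i j; rewrite !mxE; ring.
Qed.

Lemma subgrad_zE k : subgrad_z k = - (dy k + (r *: (A *m dx k) + M2 k *m dz k)).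
Proof.
rewrite /subgrad_z (incrementE y); move: (A *m _) (M2 k *m _) => a b.
by apply/matrixP => i j; rewrite !mxE; ring.
Qed.

(** Every component is a linear image of steps. The step of index k enters
through [dz_recursion]. *)
Lemma subgrad_bound : exists2 C, 0 < C & forall k,
  enorm (subgrad k.+1) <= C * (steplen k.+1 + steplen k).
Proof.
have [KA KA0 HA] := mulmx_bounded A.
have [KT KT0 HT] := mulmx_bounded A^T.
have mu2 : 0 <= sup_opnorm M2 := sup_opnorm_ge0 (A'_M2_bounded HA').
have L0 := L_gt0; have r0 := r_gt0; have mu0 := mu_ge0; have rr := rhor_gt0.
have t0 := T1_ge0; have c0 := C1_ge0.
pose s := (rho * r)^-1; have s0 : 0 < s by rewrite invr_gt0.
pose Kz := KA + s.
pose c1 := L + (KT + (mu + 2 * C1r)).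
pose c2 := 1 + (r * KA + sup_opnorm M2 * Kz).
pose c3 := s + 4 * T1r * (KA * KT).
pose c4 := 2 * C1r.
pose c5 := 4 * T1r * (KA * KT).
have KAT : 0 <= T1r * (KA * KT) by rewrite !mulr_ge0// ltW.
have rKA : 0 < r * KA by rewrite mulr_gt0.
have mKz : 0 <= sup_opnorm M2 * Kz by rewrite mulr_ge0// /Kz; lra.
exists (c1 + (c2 + (c3 + (c4 + c5)))) => [|k]; first by rewrite /c1 /c2 /c3 /c4
  /c5; lra.
set S := _ + steplen k.
have S1 : steplen k.+1 <= S by rewrite lerDl steplen_ge0.
have S2 : steplen k <= S by rewrite lerDr steplen_ge0.
have S0 : 0 <= S by rewrite addr_ge0 ?steplen_ge0.
have dxS : enorm (dx k.+1) <= S := le_trans (enorm_dx_le _) S1.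
have dyS : enorm (dy k.+1) <= S := le_trans (enorm_dy_le _) S1.
have dzS : enorm (dz k.+1) <= Kz * S.
  rewrite dz_recursion; apply: le_trans (enormB _ _) _.
  rewrite /Kz mulrDl lerD//; first exact: le_trans (HA _) (ler_wpM2l (ltW KA0)
    dxS).
  apply: le_trans (enormB _ _) _; rewrite !enorm_gap -/s -mulrDr ler_wpM2l
    ?(ltW s0)//.
  by rewrite lerD ?enorm_dy_le.
have AT : enorm (A *m (A^T *m dy k.+1)) <= KA * KT * S.
  apply: le_trans (HA _) _; rewrite -mulrA ler_wpM2l ?(ltW KA0)//.
  exact: le_trans (HT _) (ler_wpM2l (ltW KT0) dyS).
apply: le_trans (enorm_stack5 _ _ _ _ _) _.
rewrite (mulrDl c1) (mulrDl c2) (mulrDl c3) (mulrDl c4); apply: lerD;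
  last apply: lerD; last apply: lerD; last apply: lerD.
- rewrite subgrad_xE /c1 (mulrDl L) (mulrDl KT) (mulrDl mu);
  apply: le_trans (enormD _ _) _; apply: lerD.
    rewrite /xstep_gradient; case: alg; first by rewrite subrr enorm0
      mulr_ge0// ltW.
    by apply: le_trans (h_lip _ _) _; rewrite increment_def ler_wpM2l// ltW.
  apply: le_trans (enormD _ _) _; apply: lerD.
    exact: le_trans (HT _) (ler_wpM2l (ltW KT0) dyS).
  apply: le_trans (enormD _ _) _; rewrite enormN; apply: lerD.
    exact: le_trans (mulmx_sup_opnorm M1_bd _ _) (ler_wpM2l mu0 dxS).
  by rewrite enormZ ger0_norm ?mulr_ge0// ler_wpM2l// mulr_ge0.
- rewrite subgrad_zE enormN /c2 (mulrDl 1) (mulrDl (r * KA));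
  apply: le_trans (enormD _ _) _; apply: lerD.
    by rewrite mul1r.
  apply: le_trans (enormD _ _) _; apply: lerD.
    rewrite enormZ ger0_norm ?(ltW r0)// -mulrA ler_wpM2l ?(ltW r0)//.
    exact: le_trans (HA _) (ler_wpM2l (ltW KA0) dxS).
  apply: le_trans (mulmx_sup_opnorm (A'_M2_bounded HA') _ _) _.
  by rewrite -mulrA ler_wpM2l.
- rewrite /subgrad_y /c3 (mulrDl s); apply: le_trans (enormD _ _) _; apply: lerD.
    by rewrite enorm_gap ler_wpM2l// ltW.
  by rewrite enormZ ger0_norm ?mulr_ge0// -[leRHS]mulrA ler_wpM2l// mulr_ge0.
- by rewrite /subgrad_x' enormN enormZ ger0_norm ?mulr_ge0// ler_wpM2l// mulr_ge0.
- by rewrite /subgrad_y' enormN enormZ ger0_norm ?mulr_ge0// -[leRHS]mulrA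
  ler_wpM2l// mulr_ge0.
Qed.

(** * Convergence of the values and of the iterates *)

(** The indefinite terms satisfy <y, e> + r/2 |e|^2 >= - |y|^2 / (2 r), and y is
bounded. *)
Lemma regL_value_lower_bound (B : R) : (forall k, enorm (y k) <= B) ->
  exists c, forall k, c <= regL_value k.
Proof.
move=> yB; have [cg Hg] := A'_g_bounded_below HA'.
have [ch Hh] := A'_h_bounded_below HA'.
exists (cg + ch - B ^+ 2 / (2 * r)) => k.
have hg : cg <= g_value k.+1 by rewrite -lee_fin -g_finite.
have hh := Hh (x k.+1).
have nT := mulr_ge0 T1_ge0 (sqr_ge0 (enorm (A^T *m dy k))).
have nC := mulr_ge0 C1_ge0 (sqr_ge0 (enorm (dx k))).
have r0 := r_gt0.
have B0 : 0 <= B := le_trans (enorm_ge0 _) (yB 0%N).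
have yB2 : enorm (y k.+1) ^+ 2 <= B ^+ 2 by rewrite ler_pXn2r ?nnegrE ?enorm_ge0.
have sq := dot_ge0 (y k.+1 + r *: gap k).
rewrite -sqr_enorm sqr_enormD enormZ dotZr ger0_norm ?(ltW r0)// exprMn in sq.
rewrite /regL_value /augL_value gap_def.
have : - (B ^+ 2 / (2 * r)) <= dot (y k.+1) (gap k) + r / 2 * enorm (gap k) ^+ 2.
  rewrite -(ler_pM2l (_ : 0 < 2 * r)); last by rewrite mulr_gt0.
  have -> : 2 * r * - (B ^+ 2 / (2 * r)) = - B ^+ 2 by field; rewrite gt_eqF.
  have -> : 2 * r * (dot (y k.+1) (gap k) + r / 2 * enorm (gap k) ^+ 2)
     = 2 * (r * dot (y k.+1) (gap k)) + r ^+ 2 * enorm (gap k) ^+ 2 by field.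
  move: (enorm (y k.+1) ^+ 2) (r * _) (r ^+ 2 * _) sq yB2 => *; lra.
rewrite -(mulrA 2); move: (T1r * _) (C1r * _) nT nC => t c nT nC.
move: (B ^+ 2 / _) (r / 2 * _) => *.
lra.
Qed.

Lemma regL_value_cvg (B : R) : (forall k, enorm (y k) <= B) ->
  exists l : R, [/\ regL_value @ \oo --> l, forall k, l <= regL_value k &
    lim ((fun k => F (x k.+1) (z k.+1) (y k.+1) (x k) (y k)) @ \oo) = l%:E].
Proof.
move=> yB; have [c Hc] := regL_value_lower_bound yB.
have [c0 c00 dec] := sufficient_decrease.
have ni : nonincreasing_seq regL_value.
  apply/nonincreasing_seqP => k; rewrite -subr_ge0; apply: le_trans (dec k).
  by rewrite mulr_ge0 ?(ltW c00)// addr_ge0 ?sqr_ge0.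
have cv : cvgn regL_value.
  by apply: nonincreasing_is_cvgn => //; exists c => _ [k _ <-].
exists (lim (regL_value @ \oo)); split => //.
  by move=> k; exact: (nonincreasing_cvgn_ge ni cv k).
rewrite -EFin_lim//; set u := (X in lim (X @ _)).
by have -> : u = EFin \o regL_value by apply/funext => k; exact: F_iterate.
Qed.

Section Limit.
Variables (xh : 'cV[R]_n) (zh yh : 'cV[R]_m) (CL theta l B : R).
Hypotheses (CL0 : 0 < CL) (Fl : regL_value @ \oo --> l).
Hypotheses (l_le : forall k, l <= regL_value k).
Hypotheses (Hx : x @ \oo --> xh) (Hz : z @ \oo --> zh) (Hy : y @ \oo --> yh).
Hypothesis loj : lojasiewicz_at (on_stack5 F) (stack5 xh zh yh xh yh) l%:E CL
  theta.
Hypothesis zh_Axh : zh = A *m xh.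

Let E k := regL_value k - l.

Lemma value_gap_ge0 k : 0 <= E k. Proof. by rewrite subr_ge0. Qed.

Lemma value_gap_small e : 0 < e -> exists K, forall k, (K <= k)%N -> E k < e.
Proof.
move=> e0; have /cvgrPdist_lt/(_ _ e0)[K _ HK] := Fl.
exists K => k Kk; have := HK k Kk; rewrite /= distrC ger0_norm//.
exact: value_gap_ge0.
Qed.

Lemma iterate_close e : 0 < e ->
  exists K, forall k, (K <= k)%N -> enorm (iterate k - stack5 xh zh yh xh yh) < e.
Proof.
move=> e0; have e5 : 0 < e / 5 by rewrite divr_gt0.
have [K1 H1] := enorm_cvg Hx e5.
have [K2 H2] := enorm_cvg Hz e5.
have [K3 H3] := enorm_cvg Hy e5.
exists (maxn K1 (maxn K2 K3)) => k; rewrite !geq_max => /and3P[k1 k2 k3].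
rewrite /iterate stack5B; apply: le_lt_trans (enorm_stack5 _ _ _ _ _) _.
have := H1 _ k1; have := H1 _ (leqW k1); have := H2 _ (leqW k2).
have := H3 _ k3; have := H3 _ (leqW k3).
move: (enorm _) (enorm _) (enorm _) (enorm _) (enorm _) => *; lra.
Qed.

(** The Frechet subgradient of [frechet_subgrad] is a limiting one through
constant sequences, so its norm bounds the distance in the Lojasiewicz
inequality. *)
Lemma iterate_KL : exists C K, forall k, (K <= k)%N -> 0 < E k.+1 ->
  E k.+1 `^ theta <= C * (steplen k.+1 + steplen k).
Proof.
have [eps [eps0 Hl]] := loj.
have [K HK] := iterate_close eps0.
have [C C0 HC] := subgrad_bound.
exists (CL * C), K => k Kk Ek; have := Hl _ (HK _ (leqW Kk)).
rewrite {1}/iterate on_stack5E F_iterate -EFinB abse_EFin ger0_norm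
  ?value_gap_ge0//.
rewrite /pow00 eqe gt_eqF// poweR_EFin => h1.
have h2 : (edist_set 0%R (limiting_subdiff (on_stack5 F) (iterate k.+1))
    <= (enorm (subgrad k.+1))%:E)%E.
  apply: ereal_inf_lbound; exists (subgrad k.+1); last by rewrite sub0r enormN.
  have fs := frechet_subgrad k.+1; split; first exact: fs.1.
  exists (fun=> iterate k.+1), (fun=> subgrad k.+1); split => //.
  - exact: cvg_cst.
  - exact: cvg_cst.
  - exact: cvg_cst.
rewrite -lee_fin; apply: le_trans h1 _.
apply: le_trans (lee_wpmul2l _ h2) _; first by rewrite lee_fin ltW.
by rewrite -EFinM lee_fin -mulrA ler_wpM2l// ltW.
Qed.

Lemma steplen_sqr : exists2 C, 1 <= C & forall k,
  steplen k.+1 ^+ 2 <= C * (E k - E k.+1).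
Proof.
have [c c0 dec] := sufficient_decrease.
exists (Num.max 1 (2 / c)) => [|k]; first by rewrite le_max lexx.
have EE : E k - E k.+1 = regL_value k - regL_value k.+1 by rewrite /E; ring.
have h1 : steplen k.+1 ^+ 2 <= 2 / c * (E k - E k.+1).
  rewrite EE; have := ler_wpM2l (_ : 0 <= 2 / c) (dec k).
  rewrite divr_ge0 ?(ltW c0)// => /(_ isT).
  rewrite mulrA divfK ?gt_eqF//; apply: le_trans.
  rewrite /steplen; have := sqr_ge0 (enorm (dx k.+1) - enorm (dy k.+1)).
  move: (enorm _) (enorm _) => *; lra.
apply: le_trans h1 _; apply: ler_wpM2r; last by rewrite le_max lexx orbT.
rewrite EE; apply: le_trans (dec k).
by rewrite mulr_ge0 ?(ltW c0)// addr_ge0 ?sqr_ge0.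
Qed.

(** Telescoping, then passage to the limit; the bound on the partial path avoids
any infinite sum. *)
Lemma distance_to_limit N (u : nat -> 'cV[R]_N) (uh : 'cV[R]_N) (P : nat -> R) K :
  u @ \oo --> uh -> (forall k, enorm (increment u k) <= steplen k) ->
  (forall k, (K <= k)%N -> 0 <= P k) ->
  (forall k, (K <= k)%N -> steplen k.+1 <= P k - P k.+1) ->
  forall k, (K <= k)%N -> enorm (u k.+1 - uh) <= P k.
Proof.
move=> uuh us P0 Ps k Kk.
have H i : enorm (u (k + i).+1 - u k.+1) <= P k - P (k + i)%N.
  elim: i => [|i IH]; first by rewrite addn0 !subrr enorm0.
  rewrite addnS incrementE addrAC; apply: le_trans (enormD _ _) _.
  have := le_trans (us (k + i).+1) (Ps (k + i)%N (leq_trans Kk (leq_addr _ _))).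
  by move: IH; move: (enorm _) (enorm _) => *; lra.
apply/ler_addgt0Pr => e e0; have [N1 HN] := enorm_cvg uuh e0.
pose i := N1.
have h1 := HN (k + i).+1 (leqW (leq_addl _ _)).
have -> : u k.+1 - uh = (u (k + i).+1 - uh) - (u (k + i).+1 - u k.+1).
  by apply/matrixP => a b; rewrite !mxE; ring.
apply: le_trans (enormB _ _) _.
have := H i; have := P0 (k + i)%N (leq_trans Kk (leq_addr _ _)).
move: h1; move: (enorm _) (enorm _) => *; lra.
Qed.

(** The bound for z comes from z = A x - residual, where the residual is a
multiple of the last step of y. *)
Lemma error_bound (theta' C : R) K : 1 / 2 <= theta' < 1 -> 1 <= C ->
  (forall k, (K <= k)%N -> E k <= 1) ->
  (forall k, steplen k.+1 ^+ 2 <= C * (E k - E k.+1)) ->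
  (forall k, (K <= k)%N -> E k.+1 `^ theta' <= C * (steplen k.+1 + steplen k)) ->
  exists2 D, 0 < D & forall k, (K <= k)%N ->
    [/\ enorm (x k.+3 - xh) <= D * E k `^ (1 - theta'),
        enorm (y k.+3 - yh) <= D * E k `^ (1 - theta') &
        enorm (z k.+3 - zh) <= D * E k `^ (1 - theta')].
Proof.
move=> /andP[th1 th2] C1 E1 dec KL.
have [KA KA0 HA] := mulmx_bounded A.
have E01 k : (K <= k)%N -> 0 <= E k <= 1 by move=> Kk; rewrite value_gap_ge0 E1.
pose P := KL_potential theta' C E steplen.
have dec' k (_ : (K <= k)%N) := dec k.
have Pge k : steplen k <= P k by apply: KL_potential_ge th2 steplen_ge0 k.
have Pstep k : (K.+1 <= k)%N -> steplen k.+1 <= P k - P k.+1.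
  case: k => // k Kk.
  exact: (KL_potential_step th1 th2 C1 E01 steplen_ge0 dec' KL).
pose D0 := 2 * (C ^+ 2 / (1 - theta')) + 2 * C.
have D00 : 0 < D0.
  have : 0 <= C ^+ 2 / (1 - theta') by rewrite divr_ge0 ?sqr_ge0//; lra.
  rewrite /D0; lra.
have Ple k : (K <= k)%N -> P k.+2 <= D0 * E k `^ (1 - theta').
  exact: (KL_potential_le th1 th2 C1 E01 steplen_ge0 dec').
have P0 k : (K.+1 <= k)%N -> 0 <= P k.
  by move=> _; apply: le_trans (steplen_ge0 k) (Pge k).
have xb := distance_to_limit Hx enorm_dx_le P0 Pstep.
have yb := distance_to_limit Hy enorm_dy_le P0 Pstep.
have s0 : 0 < (rho * r)^-1 by rewrite invr_gt0 rhor_gt0.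
exists (D0 * (1 + KA + (rho * r)^-1)) => [|k Kk]; first by rewrite mulr_gt0//;
  lra.
have Kk2 : (K.+1 <= k.+2)%N by apply: leqW.
set w := E k `^ _.
have w0 : 0 <= w by apply: powR_ge0.
have Pw : P k.+2 <= D0 * w := Ple _ Kk.
have big : D0 * w <= D0 * (1 + KA + (rho * r)^-1) * w.
  rewrite ler_wpM2r// ler_peMr ?(ltW D00)//; lra.
split.
- exact: le_trans (xb _ Kk2) (le_trans Pw big).
- exact: le_trans (yb _ Kk2) (le_trans Pw big).
have -> : z k.+3 - zh = A *m (x k.+3 - xh) - gap k.+2.
  rewrite zh_Axh -gap_def mulmxBr; move: (A *m _) (A *m _) => a b.
  by apply/matrixP => i j; rewrite !mxE; ring.
apply: le_trans (enormB _ _) _; rewrite enorm_gap.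
have h1 := le_trans (HA _) (ler_wpM2l (ltW KA0) (xb _ Kk2)).
have h2 := ler_wpM2l (ltW s0) (le_trans (enorm_dy_le k.+2) (Pge k.+2)).
have h3 := ler_wpM2l (ltW KA0) Pw; have h4 := ler_wpM2l (ltW s0) Pw.
have := mulr_ge0 (ltW D00) w0.
move: (_^-1) (enorm _) (enorm _) (P _) h1 h2 h3 h4 => s e1 e2 p h1 h2 h3 h4 h5.
have -> : D0 * (1 + KA + s) * w = D0 * w + KA * (D0 * w) + s * (D0 * w) by ring.
lra.
Qed.

Lemma KL_setup : exists C K, [/\ 1 <= C, forall k, (K <= k)%N -> E k <= 1,
  forall k, steplen k.+1 ^+ 2 <= C * (E k - E k.+1) &
  forall k, (K <= k)%N -> 0 < E k.+1 ->
    E k.+1 `^ theta <= C * (steplen k.+1 + steplen k)].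
Proof.
have [Ca [Ka HKL]] := iterate_KL.
have [Cb Cb1 dec] := steplen_sqr.
have [Kb HE] := value_gap_small ltr01.
exists (Num.max Ca Cb), (maxn Ka Kb); split.
- by rewrite le_max Cb1 orbT.
- by move=> k; rewrite geq_max => /andP[_ /HE /ltW].
- move=> k; apply: le_trans (dec k) _; apply: ler_wpM2r.
    have := le_trans (sqr_ge0 _) (dec k).
    by rewrite pmulr_rge0// (lt_le_trans ltr01 Cb1).
  by rewrite le_max lexx orbT.
- move=> k; rewrite geq_max => /andP[Kk _] Ek.
  apply: le_trans (HKL _ Kk Ek) _; apply: ler_wpM2r.
    by rewrite addr_ge0 ?steplen_ge0.
  by rewrite le_max lexx.
Qed.

(** For values in (0, 1] a larger exponent gives a smaller power. The case of
value 0 is covered since theta' > 0, even for theta = 0. *)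
Lemma KL_raise_exponent theta' C k : theta <= theta' -> 0 < theta' -> 0 <= C ->
  E k.+1 <= 1 ->
  (0 < E k.+1 -> E k.+1 `^ theta <= C * (steplen k.+1 + steplen k)) ->
  E k.+1 `^ theta' <= C * (steplen k.+1 + steplen k).
Proof.
move=> le th'0 C0 E1 KL.
have := value_gap_ge0 k.+1; rewrite le_eqVlt => /predU1P[<-|E0].
  rewrite powR0 ?gt_eqF//; apply: mulr_ge0 => //.
  by rewrite addr_ge0 ?steplen_ge0.
by apply: le_trans (KL E0); apply: ger_powR; rewrite ?E0.
Qed.

(** * Rates of convergence *)

Lemma half_bd : ((1 / 2 : R) <= 1 / 2 < (1 : R))%R.
Proof. by apply/andP; split; lra. Qed.

Lemma half_exponent : 1 - 1 / 2 = 1 / 2 :> R. Proof. lra. Qed.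

(** As long as a value is nonzero, the steps before it are bounded below,
whereas they are also bounded by a value that tends to 0. Once the values
vanish, so do the distances, by [error_bound] with exponent 1/2. *)
Lemma finite_termination : theta = 0 ->
  exists k0, forall k, (k0 <= k)%N -> [/\ x k = xh, z k = zh & y k = yh].
Proof.
move=> th0; have [C [K [C1 E1 dec KL]]] := KL_setup.
have C0 : 0 < C := lt_le_trans ltr01 C1.
have KL' k : (K <= k)%N -> E k.+1 `^ (1 / 2) <= C * (steplen k.+1 + steplen k).
  by move=> Kk; apply: KL_raise_exponent (ltW C0) (E1 _ (leqW Kk)) (KL _ Kk);
    rewrite ?th0; lra.
have C3 : 0 < 2 * C ^+ 3 by rewrite mulr_gt0 ?exprn_gt0.
have iC3 : 0 < (2 * C ^+ 3)^-1 by rewrite invr_gt0.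
have [K1 HK1] := value_gap_small iC3.
have E0 k : (maxn K K1 <= k)%N -> E k.+2 = 0.
  rewrite geq_max => /andP[Kk K1k]; apply/eqP; rewrite eq_le value_gap_ge0 andbT.
  rewrite leNgt; apply/negP => Epos.
  have := KL _ (leqW Kk) Epos; rewrite th0 powRr0 => h1.
  have h2 : 1 <= (C * (steplen k.+2 + steplen k.+1)) ^+ 2 by rewrite exprn_ege1.
  have h3 := two_steps_le (fun k (_ : (K <= k)%N) => dec k) Kk.
  have h4 := le_trans h2 h3.
  have := HK1 _ K1k; rewrite -(ltr_pM2l C3) mulfV ?gt_eqF// => h5.
  have h6 := mulr_ge0 (ltW C3) (value_gap_ge0 k.+2).
  move: h4; rewrite mulrBr => h4; lra.
have [D D0 HD] := error_bound half_bd C1 E1 dec KL'.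
(* two indices from the vanishing of the values and three from the error bound *)
exists (maxn K K1).+2.+3 => k k0.
have [j -> Kj] : exists2 j, k = j.+2.+3 & (maxn K K1 <= j)%N.
  by case: k k0 => [|[|[|[|[|j]]]]] //; exists j.
have [|hx hy hz] := HD j.+2; first by rewrite !leqW// (leq_trans (leq_maxl _ _)
  Kj).
have Ew : E j.+2 `^ (1 - 1 / 2) = 0.
  by rewrite E0// powR0// gt_eqF//; lra.
have e0 N (u v : 'cV[R]_N) : enorm (u - v) <= D * E j.+2 `^ (1 - 1 / 2) -> u = v.
  rewrite Ew mulr0 => uv; apply/subr0_eq/enorm_eq0/eqP.
  by rewrite eq_le uv enorm_ge0.
by split; apply: e0.
Qed.

Lemma linear_rate : 0 < theta <= 1 / 2 ->
  exists (k0 : nat) (D Q : R), [/\ (1 <= k0)%N, 0 < D, 0 <= Q < 1 &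
    forall k, (k0 <= k)%N -> [/\ enorm (x k - xh) <= D * Q ^+ k,
      enorm (y k - yh) <= D * Q ^+ k & enorm (z k - zh) <= D * Q ^+ k]].
Proof.
move=> /andP[th0 th2]; have [C [K [C1 E1 dec KL]]] := KL_setup.
have C0 : 0 < C := lt_le_trans ltr01 C1.
have KL' k : (K <= k)%N -> E k.+1 `^ (1 / 2) <= C * (steplen k.+1 + steplen k).
  by move=> Kk; apply: KL_raise_exponent (ltW C0) (E1 _ (leqW Kk)) (KL _ Kk); lra.
have [D D0 HD] := error_bound half_bd C1 E1 dec KL'.
have sqE k : (E k `^ (1 / 2)) ^+ 2 = E k.
  by rewrite -powR_mulrn ?powR_ge0// -powRrM divfK// powRr1// value_gap_ge0.
have rec k : (K <= k)%N -> E k.+2 <= 2 * C ^+ 3 * (E k - E k.+2).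
  by move=> Kk; rewrite -{1}sqE; apply: (KL_value_step C1 steplen_ge0 (fun k (_
    : (K <= k)%N) => dec k) KL').
have C3 : 0 < 2 * C ^+ 3 by rewrite mulr_gt0 ?exprn_gt0.
have [D1 [Q [D10 /andP[Q0 Q1] HQ]]] := two_step_linear C3 (fun k _ =>
  value_gap_ge0 k) rec.
have Q3 : 0 < Q ^+ 3 by rewrite exprn_gt0.
exists K.+3, (D * D1 / Q ^+ 3), Q; split => //.
- by rewrite divr_gt0// mulr_gt0.
- by rewrite ltW.
move=> k k0; have [j -> Kj] : exists2 j, k = j.+3 & (K <= j)%N.
  by case: k k0 => [|[|[|j]]] //; exists j.
have Ew : D * E j `^ (1 - 1 / 2) <= D * D1 / Q ^+ 3 * Q ^+ j.+3.
  have -> : D * D1 / Q ^+ 3 * Q ^+ j.+3 = D * (D1 * Q ^+ j).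
    by rewrite -[j.+3]add3n exprD mulrA divfK ?gt_eqF// mulrA.
  rewrite ler_wpM2l ?(ltW D0)// half_exponent.
  rewrite -(ler_pXn2r (_ : 0 < 2)%N) ?nnegrE ?powR_ge0//; last first.
    by rewrite mulr_ge0 ?exprn_ge0 ?ltW.
  by rewrite sqE HQ.
by have [hx hy hz] := HD _ Kj; split; apply: le_trans Ew.
Qed.

Lemma sublinear_rate (gamma := (1 - theta) / (2 * theta - 1)) : 1 / 2 < theta <
  1 ->
  exists (k0 : nat) (D : R), [/\ (3 <= k0)%N, 0 < D &
    forall k, (k0 <= k)%N -> [/\ enorm (x k - xh) <= D * (k%:R - 1) `^ (- gamma),
      enorm (y k - yh) <= D * (k%:R - 1) `^ (- gamma) &
      enorm (z k - zh) <= D * (k%:R - 2) `^ (- gamma)]].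
Proof.
move=> th; have /andP[th1 th2] := th.
have [C [K [C1 E1 dec KL]]] := KL_setup.
have C0 : 0 < C := lt_le_trans ltr01 C1.
have KL' k : (K <= k)%N -> E k.+1 `^ theta <= C * (steplen k.+1 + steplen k).
  by move=> Kk; apply: KL_raise_exponent (ltW C0) (E1 _ (leqW Kk)) (KL _ Kk); lra.
have th' : 1 / 2 <= theta < 1 by rewrite ltW.
have [D D0 HD] := error_bound th' C1 E1 dec KL'.
have C3 : 1 <= 2 * C ^+ 3 by have := exprn_ege1 3 C1; lra.
have E01 k : (K <= k)%N -> 0 <= E k <= 1 by move=> Kk; rewrite value_gap_ge0 E1.
have rec k : (K <= k)%N ->
    (E k.+2 `^ theta) ^+ 2 <= 2 * C ^+ 3 * (E k - E k.+2).
  exact: (KL_value_step C1 steplen_ge0 (fun k (_ : (K <= k)%N) => dec k) KL').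
have [D1 D10 HE] := two_step_sublinear th C3 E01 rec.
rewrite -/gamma in HE.
have g0 : 0 <= gamma by rewrite divr_ge0//; lra.
have two1 : 1 <= 2 `^ gamma :> R.
  rewrite -[leLHS](powRr0 2); apply: ler_powR; [lra|exact: g0].
have DD0 : 0 < D * D1 by rewrite mulr_gt0.
exists K.+3, (D * D1 * 2 `^ gamma); split => //.
  by rewrite mulr_gt0// (lt_le_trans ltr01 two1).
move=> k k0; have [j -> Kj] : exists2 j, k = j.+3 & (K <= j)%N.
  by case: k k0 => [|[|[|j]]] //; exists j.
have -> : j.+3%:R - 1 = j.+2%:R :> R by rewrite -addn1 natrD addrK.
have -> : j.+3%:R - 2 = j.+1%:R :> R by rewrite -addn2 natrD addrK.
have hE : D * E j `^ (1 - theta) <= D * D1 * j.+1%:R `^ (- gamma).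
  by rewrite -mulrA ler_wpM2l ?(ltW D0)// HE.
have hz : D * E j `^ (1 - theta) <= D * D1 * 2 `^ gamma * j.+1%:R `^ (- gamma).
  apply: le_trans hE _; rewrite ler_wpM2r ?powR_ge0// ler_peMr// ltW//.
have hx : D * E j `^ (1 - theta) <= D * D1 * 2 `^ gamma * j.+2%:R `^ (- gamma).
  apply: le_trans hE _; rewrite -[leRHS]mulrA ler_wpM2l ?(ltW DD0)//.
  rewrite !powRN ler_pdivlMr ?powR_gt0// mulrC ler_pdivrMr ?powR_gt0//.
  rewrite -powRM ?ler0n//; apply: (ge0_ler_powR g0);
    rewrite ?nnegrE ?mulr_ge0 ?ler0n//.
  have -> : j.+2%:R = j%:R + 2 :> R by rewrite -addn2 natrD.
  have -> : j.+1%:R = j%:R + 1 :> R by rewrite -addn1 natrD.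
  by have := ler0n R j; lra.
by have [h1 h2 h3] := HD _ Kj; split;
  [apply: le_trans h1 hx|apply: le_trans h2 hx|apply: le_trans h3 hz].
Qed.

End Limit.

End ADMM.

Theorem theorem20 (R : realType) (m n : nat) (alg : algorithm)
  (g : 'cV[R]_m -> \bar R) (h : 'cV[R]_n -> R) (L : R) (A : 'M[R]_(m, n))
  (M1 : nat -> 'M[R]_n) (M2 : nat -> 'M[R]_m) (r rho : R)
  (x : nat -> 'cV[R]_n) (z y : nat -> 'cV[R]_m)
  (xh : 'cV[R]_n) (zh yh : 'cV[R]_m) (CL theta : R)
  (g_proper : proper_fun g)
  (g_lsc : lower_semicontinuous g)
  (h_diff : forall u, differentiable h u)
  (h_lip : forall u v,
     enorm (gradient h u - gradient h v) <= L * enorm (u - v))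
  (M1_psd : forall k, sym_psd (M1 k))
  (M2_psd : forall k, sym_psd (M2 k))
  (r_gt0 : 0 < r) (rho_bd : 0 < rho < 2)
  (HA' : assumptionA' alg g h L A M1 M2 r rho)
  (Hgen : generated_by alg g h A M1 M2 r rho x z y)
  (Hbounded : exists B : R, forall k,
     [/\ enorm (x k) <= B, enorm (z k) <= B & enorm (y k) <= B])
  (F := regL alg g h L A (sup_opnorm M1) r rho)
  (Fstar := lim ((fun k : nat => F (x k.+1) (z k.+1) (y k.+1) (x k) (y k))
                   @ \oo))
  (HF_loj : lojasiewicz_property (on_stack5 F))
  (CL_gt0 : 0 < CL) (theta_bd : 0 <= theta < 1)
  (HF_loj_at :
     lojasiewicz_at (on_stack5 F) (stack5 xh zh yh xh yh) Fstar CL theta)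
  (HKKT : is_KKT g h A xh zh yh)
  (Hx : x @ \oo --> xh) (Hz : z @ \oo --> zh) (Hy : y @ \oo --> yh) :
  [/\ theta = 0 ->
        exists k0 : nat, forall k : nat, (k0 <= k)%N ->
          [/\ x k = xh, z k = zh & y k = yh],
      0 < theta <= 1 / 2 ->
        exists (k0 : nat) (C01 C02 C03 Q : R),
          [/\ (1 <= k0)%N, [/\ 0 < C01, 0 < C02 & 0 < C03], 0 <= Q < 1 &
            forall k : nat, (k0 <= k)%N ->
              [/\ enorm (x k - xh) <= C01 * Q ^+ k,
                  enorm (y k - yh) <= C02 * Q ^+ k &
                  enorm (z k - zh) <= C03 * Q ^+ k]] &
      1 / 2 < theta < 1 ->
        exists (k0 : nat) (C11 C12 C13 : R),
          [/\ (3 <= k0)%N, [/\ 0 < C11, 0 < C12 & 0 < C13] &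
            forall k : nat, (k0 <= k)%N ->
              [/\ enorm (x k - xh)
                    <= C11 * (k%:R - 1) `^ (- ((1 - theta) / (2 * theta - 1))),
                  enorm (y k - yh)
                    <= C12 * (k%:R - 1) `^ (- ((1 - theta) / (2 * theta - 1))) &
                  enorm (z k - zh)
                    <= C13 * (k%:R - 2)
                               `^ (- ((1 - theta) / (2 * theta - 1)))]]].
Proof.
have [B HB] := Hbounded.
have yB k : enorm (y k) <= B by case: (HB k).
have [_ _ zh_Axh] := HKKT.
have [l [Fl l_le FE]] :=
  regL_value_cvg g_proper h_diff h_lip M2_psd M1_psd r_gt0 rho_bd HA' Hgen yB.
rewrite /Fstar FE in HF_loj_at.
split=> [th0|th|th].
- exact: (finite_termination g_proper h_diff h_lip M2_psd M1_psd r_gt0 rho_bd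
    HA' Hgen CL_gt0 Fl l_le Hx Hz Hy HF_loj_at zh_Axh).
- have [k0 [D [Q [k01 D0 Q01 HD]]]] :=
    linear_rate g_proper h_diff h_lip M2_psd M1_psd r_gt0 rho_bd
      HA' Hgen CL_gt0 Fl l_le Hx Hz Hy HF_loj_at zh_Axh th.
  by exists k0, D, D, D, Q.
- have [k0 [D [k03 D0 HD]]] :=
    sublinear_rate g_proper h_diff h_lip M2_psd M1_psd r_gt0 rho_bd
      HA' Hgen CL_gt0 Fl l_le Hx Hz Hy HF_loj_at zh_Axh th.
  by exists k0, D, D, D.
Qed.
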